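(* Let $F_2$ denote the free group of rank $2$, and let $\varphi\colon F_2\times F_2\times F_2\to\mathbb{Z}^2$ be a homomorphism whose restriction to each of the three factors is surjective. Then the kernel $\ker\varphi$ (which is finitely presented) has Dehn function $\delta_{\ker\varphi}(N)\asymp N^4$.
   Context: For a finitely presented group $G=\langle S\mid\mathcal R\rangle$, the area of a word $w\in F(S)$ representing the identity is the least $M$ such that $w=\prod_{i=1}^M u_i^{-1}R_iu_i$ in $F(S)$ with $u_i\in F(S)$, $R_i\in\mathcal R^{\pm1}$; the Dehn function is $\delta_G(N)=\max\{\mathrm{Area}(w): |w|\le N,\ w=_G1\}$. For $f,g\colon\mathbb N\to\mathbb N$ write $f\preccurlyeq g$ if there is $C>0$ with $f(N)\le Cg(CN+C)+CN+C$ for all $N$, and $f\asymp g$ if $f\preccurlyeq g$ and $g\preccurlyeq f$; up to $\asymp$ the Dehn function does not depend on the finite presentation. *)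

(* Defs.v *)
(* Free groups are modelled by words over a finite alphabet
   with formal inverses, up to free reduction; presentations, area and Dehn
   functions follow the paper's definitions. *)
From Stdlib Require Import ClassicalEpsilon.
From mathcomp Require Import all_boot all_order all_algebra.
Set Implicit Arguments. Unset Strict Implicit. Unset Printing Implicit Defensive.

Section Words.
Variable S : eqType.
(* (s, true) is the letter s, (s, false) is s^-1 *)
Definition word := seq (S * bool).
Definition linv (x : S * bool) : S * bool := (x.1, ~~ x.2).
Definition winv (w : word) : word := rev (map linv w).
Definition push (acc : word) (x : S * bool) : word :=
  match acc with
  | y :: acc' => if y == linv x then acc' else x :: acc
  | [::] => [:: x]
  end.
Definition freduce (w : word) : word := rev (foldl push [::] w).
Definition freeeq (u v : word) : Prop := freduce u = freduce v.
End Words.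

Section Pres.
Variables (S : finType) (R : seq (word S)).

Definition conj_rel (u r : word S) : word S := winv u ++ r ++ u.

Definition area_le (w : word S) (M : nat) : Prop :=
  exists l : seq (word S * word S * bool),
    size l <= M /\ (forall p, p \in l -> p.1.2 \in R) /\
    freeeq w (flatten [seq conj_rel p.1.1 (if p.2 then p.1.2 else winv p.1.2)
                      | p <- l]).

Definition null_hom (w : word S) : Prop := exists M, area_le w M.

(* least M with area_le w M (meaningful for null-homotopic w) *)
Definition Area (w : word S) : nat :=
  epsilon (inhabits 0%N)
    (fun M => area_le w M /\ forall M', area_le w M' -> M <= M').

Definition Dehn (N : nat) : nat :=
  epsilon (inhabits 0%N)
    (fun D => (exists w, size w <= N /\ null_hom w /\ Area w = D) /\
              forall w, size w <= N -> null_hom w -> Area w <= D).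
End Pres.

Definition dehn_le (f g : nat -> nat) : Prop :=
  exists C, 0 < C /\ forall N, f N <= C * g (C * N + C) + C * N + C.
Definition dehn_equiv (f g : nat -> nat) : Prop := dehn_le f g /\ dehn_le g f.

(* an element of F2^3 is represented by a triple (indexed by 'I_3) of words
   over the two free generators 'I_2 *)
Definition triple := 'I_3 -> word 'I_2.
Definition tmul (x y : triple) : triple := fun i => x i ++ y i.
Definition tinv (x : triple) : triple := fun i => winv (x i).
Definition tone : triple := fun _ => [::].
Definition teq (x y : triple) : Prop := forall i, freeeq (x i) (y i).

Definition is_hom3 (phi : triple -> 'rV[int]_2) : Prop :=
  (forall x y, teq x y -> phi x = phi y) /\
  (forall x y, phi (tmul x y) = (phi x + phi y)%R).

Definition factor_inj (i : 'I_3) (u : word 'I_2) : triple :=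
  fun j => if j == i then u else [::].

Definition factor_surj (phi : triple -> 'rV[int]_2) : Prop :=
  forall (i : 'I_3) (z : 'rV[int]_2), exists u, phi (factor_inj i u) = z.

Definition teval (S : eqType) (psi : S -> triple) (w : word S) : triple :=
  foldr (fun x acc => tmul (if x.2 then psi x.1 else tinv (psi x.1)) acc)
        tone w.

(* s |-> psi s induces an isomorphism < S | R > ~= ker phi *)
Definition presents_kernel (S : finType) (R : seq (word S))
    (phi : triple -> 'rV[int]_2) (psi : S -> triple) : Prop :=
  [/\ (forall s, phi (psi s) = 0%R),
      (forall r, r \in R -> teq (teval psi r) tone),
      (forall x, phi x = 0%R -> exists w, teq (teval psi w) x) &
      (forall w, teq (teval psi w) tone -> null_hom R w)].

(* Main.v *)
(* Every surjection F_2 -> Z^2 becomes the abelianization in a suitable basis of F_2,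
   so one may take the standard kernel K, generated by x_i = (a_i, 1, a_i^-1) and
   y_i = (1, a_i, a_i^-1).

   Upper bound.  A null-homotopic word of length N spells a closed path in F_2^3 that
   stays at height O(N) over Z^2.  With s(h) = a_1^h_1 a_2^h_2, an edge g -> g a of
   F_2^3 at height h is pushed to the element s(h) a s(h')^-1 of K (with s(h) and s(h')
   in the third factor), written as a word of length O(|h|).  Filling the path
   takes O(N^2) commutation squares between edges of different factors.  With one
   choice of words for the edges of the third factor the squares involving the first
   factor have area O(|h|^2), with another choice those involving the second factor do,
   and passing between the two choices costs O(|h|^3) for each of the O(N) edges.  So
   one moves out and cancels the edges of the first factor, switches the words, then
   moves out and cancels the edges of the second factor.  The total is O(N^4).

   Lower bound.  K has a central extension by Z in which the commutator of
   ([a_1^n, a_2^n], 1, 1) and (1, 1, [a_1^-n, a_2^-n]) is the element 2 n^4 of Z.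
   Conjugates of relators lie in Z and are bounded there, so this word of length 20 n
   has area at least a multiple of n^4. *)
From HB Require Import structures.
From Stdlib Require Import ZArith ClassicalEpsilon.
Require Import Defs.
From mathcomp Require Import all_boot all_order all_algebra zify.
Set Implicit Arguments. Unset Strict Implicit. Unset Printing Implicit Defensive.
Import GRing.Theory.

(** * Free groups *)

Section FreeReduction.
Variable S : eqType.
Implicit Types (u v w acc : word S) (x y : S * bool).

Lemma linvK : involutive (@linv S).
Proof. by case=> s b; rewrite /linv /= negbK. Qed.

Fixpoint reduced w : bool :=
  if w is x :: w' then (if w' is y :: _ then y != linv x else true) && reduced w'
  else true.

Lemma reduced_push acc x : reduced acc -> reduced (push acc x).
Proof.
case: acc => [//|y acc] /=; case: eqP => [_ /andP[]//|/eqP ne H] /=.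
by rewrite ne.
Qed.

Lemma reduced_foldl acc w : reduced acc -> reduced (foldl (@push S) acc w).
Proof. by elim: w acc => [//|x w IH] acc H /=; apply/IH/reduced_push. Qed.

Lemma pushK acc x : reduced acc -> push (push acc x) (linv x) = acc.
Proof.
case: acc => [|y acc] /=; first by rewrite linvK eqxx.
case: eqP => [-> |_ _] /=; last by rewrite linvK eqxx.
case: acc => [//|z acc] /= /andP[]; rewrite linvK => ne _.
by rewrite (negbTE ne).
Qed.

(** A stack is a word read backwards. When [x] cancels the top letter, replaying the stack pushes
    that letter and [x] then undoes it by [pushK], which requires [acc] to be reduced. *)
Lemma foldl_push_unwind acc w x : reduced acc ->
  foldl (@push S) acc (rev (push w x)) = push (foldl (@push S) acc (rev w)) x.
Proof.
move=> Ha; case: w => [//|y w] /=; case: eqP => [->|_]; last first.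
  by rewrite !rev_cons -!cats1 !foldl_cat.
rewrite rev_cons -cats1 foldl_cat.
rewrite -[RHS]/(push (push (foldl (@push S) acc (rev w)) (linv x)) x).
by rewrite -{2}[x]linvK pushK // reduced_foldl.
Qed.

Lemma foldl_push_freduce acc w : reduced acc ->
  foldl (@push S) acc (freduce w) = foldl (@push S) acc w.
Proof.
move=> Ha; rewrite /freduce; elim/last_ind: w => [//|w x IH].
by rewrite -cats1 !foldl_cat /= foldl_push_unwind // IH.
Qed.

Lemma freduce_catl u v : freduce (freduce u ++ v) = freduce (u ++ v).
Proof. by rewrite /freduce !foldl_cat -/(freduce u) foldl_push_freduce. Qed.

Lemma freduce_catr u v : freduce (u ++ freduce v) = freduce (u ++ v).
Proof. by rewrite /freduce !foldl_cat -/(freduce v) foldl_push_freduce // reduced_foldl. Qed.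

Lemma freduceK w : freduce (freduce w) = freduce w.
Proof. by have := freduce_catl w [::]; rewrite !cats0. Qed.

Lemma winv_cat u v : winv (u ++ v) = winv v ++ winv u.
Proof. by rewrite /winv map_cat rev_cat. Qed.

Lemma winvK : involutive (@winv S).
Proof.
move=> w; rewrite /winv map_rev revK -map_comp -[RHS]map_id.
by apply: eq_map => x; apply: linvK.
Qed.

Lemma freduce_cancel x u v : freduce (u ++ [:: x; linv x] ++ v) = freduce (u ++ v).
Proof. by rewrite /freduce !foldl_cat /= pushK // reduced_foldl. Qed.

Lemma freduce_winvr w : freduce (w ++ winv w) = [::].
Proof.
elim/last_ind: w => [//|w x IH]; rewrite -cats1 winv_cat -catA.
exact: etrans (freduce_cancel x w (winv w)) IH.
Qed.

Lemma freduce_winvl w : freduce (winv w ++ w) = [::].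
Proof. by rewrite -{2}[w]winvK freduce_winvr. Qed.

(** Each pair deleted by reduction acts trivially. Evaluation in a group, walks along edges and the
    counter of the lower bound all descend to reduced words in this way. *)
Lemma act_freduce (T : Type) (act : T -> S * bool -> T) :
  (forall a x, act (act a x) (linv x) = a) ->
  forall w a, foldl act a (freduce w) = foldl act a w.
Proof.
move=> K w a; rewrite /freduce; elim/last_ind: w => [//|w x IH].
rewrite -cats1 !foldl_cat -IH; case: (foldl _ [::] w) => [//|y acc].
rewrite [foldl (@push S) _ _]/=; case: (y =P linv x) => [->|_].
  by rewrite rev_cons -cats1 foldl_cat /= -{2}(linvK x) K.
by rewrite [in LHS]rev_cons -cats1 foldl_cat.
Qed.

(** Reduced words are unique representatives, so equality in the group is Leibniz equality. *)
Record free_group := FreeGroup { fval : word S; _ : freduce fval == fval }.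
HB.instance Definition _ := [isSub for fval].
HB.instance Definition _ := [Equality of free_group by <:].
End FreeReduction.

HB.instance Definition _ (S : choiceType) := [Choice of free_group S by <:].

Section FreeGroupLaws.
Variable S : choiceType.
Implicit Types (u v w : word S) (g h : free_group S).

Definition fgw w : free_group S := FreeGroup (introT eqP (freduceK w)).

Lemma fgwP u v : fgw u = fgw v <-> freeeq u v.
Proof. by split=> [[]//|H]; apply: val_inj. Qed.

Lemma fgw_val g : fgw (fval g) = g.
Proof. by apply: val_inj; case: g => w /= /eqP. Qed.

Definition fg_mul g h := fgw (fval g ++ fval h).
Definition fg_inv g := fgw (winv (fval g)).

Lemma fgw_cat_aux u v : fgw (u ++ v) = fg_mul (fgw u) (fgw v).
Proof. by apply/fgwP; rewrite /freeeq freduce_catl freduce_catr. Qed.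

Lemma fg_mulA : associative fg_mul.
Proof.
move=> x y z; rewrite -(fgw_val x) -(fgw_val y) -(fgw_val z).
by rewrite -!fgw_cat_aux catA.
Qed.

Lemma fg_mul1 : left_id (fgw [::]) fg_mul.
Proof. by move=> x; rewrite -(fgw_val x) -fgw_cat_aux. Qed.

Lemma fg_mulr1 : right_id (fgw [::]) fg_mul.
Proof. by move=> x; rewrite -(fgw_val x) -fgw_cat_aux cats0. Qed.

Lemma fg_mulV : left_inverse (fgw [::]) fg_inv fg_mul.
Proof.
by move=> x; rewrite -{2}(fgw_val x) -fgw_cat_aux; apply/fgwP/freduce_winvl.
Qed.

Lemma fg_mulrV : right_inverse (fgw [::]) fg_inv fg_mul.
Proof.
by move=> x; rewrite -{1}(fgw_val x) -fgw_cat_aux; apply/fgwP/freduce_winvr.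
Qed.
HB.instance Definition _ := isGroup.Build (free_group S)
  fg_mulA fg_mul1 fg_mulr1 fg_mulV fg_mulrV.

Local Open Scope group_scope.

Lemma fgw_nil : fgw [::] = 1. Proof. by []. Qed.

Lemma fgw_cat u v : fgw (u ++ v) = fgw u * fgw v.
Proof. exact: fgw_cat_aux. Qed.

Lemma fgw_winv w : fgw (winv w) = (fgw w)^-1.
Proof.
apply: (mulgI (fgw w)); rewrite mulgV -fgw_cat.
exact/fgwP/freduce_winvr.
Qed.
End FreeGroupLaws.

Section Evaluation.
Local Open Scope group_scope.
Variables (S : choiceType) (G : groupType) (f : S -> G).

Definition ev_letter (x : S * bool) : G := if x.2 then f x.1 else (f x.1)^-1.
Definition ev (w : word S) : G := foldr (fun x g => ev_letter x * g) 1 w.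

Lemma ev_cat u v : ev (u ++ v) = ev u * ev v.
Proof. by elim: u => [|x u IH] /=; rewrite ?mul1g // IH mulgA. Qed.

Lemma ev_linv x : ev_letter (linv x) = (ev_letter x)^-1.
Proof. by case: x => s [] /=; rewrite /ev_letter /= ?invgK. Qed.

Lemma ev_winv w : ev (winv w) = (ev w)^-1.
Proof.
elim: w => [|x w IH] /=; first by rewrite invg1.
by rewrite -[x :: w]cat1s winv_cat ev_cat IH /= ev_linv mulg1 invgM.
Qed.

Lemma ev_foldl w g : foldl (fun h x => h * ev_letter x) g w = g * ev w.
Proof. by elim: w g => [|x w IH] g /=; rewrite ?mulg1 // IH mulgA. Qed.

Lemma ev_freduce w : ev (freduce w) = ev w.
Proof.
rewrite -[LHS]mul1g -[RHS]mul1g -!ev_foldl act_freduce // => g x.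
by rewrite ev_linv mulgK.
Qed.

Lemma ev_freeeq u v : freeeq u v -> ev u = ev v.
Proof. by move=> H; rewrite -ev_freduce H ev_freduce. Qed.
End Evaluation.

Lemma ev_fgw (S : choiceType) (w : word S) : ev (fun s => fgw [:: (s, true)]) w = fgw w.
Proof.
elim: w => [//|[s b] w IH] /=; rewrite IH -cat1s fgw_cat; congr (_ * _)%g.
by case: b => //; rewrite /ev_letter /= -fgw_winv.
Qed.

(** * Area as a conjugation-invariant norm *)

Ltac gsimp := rewrite /conjg /commg;
  rewrite ?(invgM, invgK, invg1, mulg1, mul1g, mulgA, mulgV, mulVg, mulgK, mulgVK).

Section Cost.
Local Open Scope group_scope.
Variables (G : groupType) (A : nat -> G -> Prop).

(** The rules obeyed by elements of area at most [n], abstracted from words: products add costs,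
    conjugation costs nothing. *)
Record area_norm : Prop := AreaNorm {
  norm1 : A 0 1;
  normM : forall m n g h, A m g -> A n h -> A (m + n) (g * h);
  normV : forall n g, A n g -> A n g^-1;
  normJ : forall n g h, A n g -> A n (g ^ h);
  normW : forall m n g, m <= n -> A m g -> A n g }.

Hypothesis HA : area_norm.
Implicit Types (a b c r u v w : G) (m n k : nat).

Definition near n u v := A n (u * v^-1).
Definition comm n a b := near n (a * b) (b * a).

Lemma nearW m n u v : near m u v -> m <= n -> near n u v.
Proof. by move=> H le; apply: normW H. Qed.

Lemma near0 u v : u = v -> near 0 u v.
Proof. by move=> ->; rewrite /near mulgV; apply: norm1. Qed.

Lemma near_sym n u v : near n u v -> near n v u.
Proof. by move/(normV HA); rewrite /near; gsimp. Qed.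

Lemma near_trans v m n u w : near m u v -> near n v w -> near (m + n) u w.
Proof. by move=> H /(normM HA H); rewrite /near; gsimp. Qed.

Lemma nearM m n u u' v v' : near m u u' -> near n v v' -> near (m + n) (u * v) (u' * v').
Proof.
move=> H1 /(normJ HA u^-1) /(normM HA)/(_ H1); rewrite addnC /near.
by gsimp.
Qed.

Lemma nearMl n u v w : near n u v -> near n (w * u) (w * v).
Proof. by move=> H; apply: nearW (nearM (near0 (erefl w)) H) _. Qed.

Lemma nearMr n u v w : near n u v -> near n (u * w) (v * w).
Proof. by move=> H; apply: nearW (nearM H (near0 (erefl w))) _; lia. Qed.

Lemma nearV n u v : near n u v -> near n u^-1 v^-1.
Proof. by move/near_sym/(normJ HA u); rewrite /near; gsimp. Qed.

Lemma nearJ n u v w : near n u v -> near n (u ^ w) (v ^ w).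
Proof. by move=> H; apply/nearMl/nearMr. Qed.

Lemma nearJr n u v w : near n u v -> near (n + n) (w ^ u) (w ^ v).
Proof.
by move=> H; apply: nearM; [apply: nearV|apply: nearMl].
Qed.

Lemma nearX n k u v : near n u v -> near (k * n) (u ^+ k) (v ^+ k).
Proof.
move=> H; elim: k => [|k IH]; first by apply: near0.
by rewrite !expgS mulSn; apply: nearM.
Qed.

Lemma comm_nearJ n a b : comm n a b <-> near n (a ^ b) a.
Proof.
rewrite /comm /near; split=> [/(normJ HA b)|/(normJ HA b^-1)]; by gsimp.
Qed.

Lemma comm_sym n a b : comm n a b -> comm n b a.
Proof. exact: near_sym. Qed.

Lemma comm_refl a : comm 0 a a.
Proof. exact: near0. Qed.

Lemma commW m n a b : comm m a b -> m <= n -> comm n a b.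
Proof. exact: nearW. Qed.

Lemma commM m n a b c : comm m a b -> comm n a c -> comm (m + n) a (b * c).
Proof.
move=> /comm_nearJ H1 /comm_nearJ H2; apply/comm_nearJ; rewrite conjgM.
by apply: near_trans (nearJ _ H1) H2.
Qed.

Lemma commV n a b : comm n a b -> comm n a b^-1.
Proof.
by move=> /comm_nearJ/(nearJ b^-1)/near_sym; rewrite conjgK => /comm_nearJ.
Qed.

Lemma commVl n a b : comm n a b -> comm n a^-1 b.
Proof. by move=> H; apply/comm_sym/commV/comm_sym. Qed.

Lemma commX n k a b : comm n a b -> comm (k * n) a (b ^+ k).
Proof.
move=> H; elim: k => [|k IH]; first by apply: near0; rewrite mulg1 mul1g.
by rewrite expgS mulSn; apply: commM.
Qed.

Lemma commJ m n a b w : comm m a b -> comm n a w -> comm (m + 2 * n) a (b ^ w).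
Proof.
move=> H1 H2; apply: commW (commM (commV H2) (commM H1 H2)) _; lia.
Qed.

Lemma comm_near m n a b c : near m b c -> comm n a b -> comm (n + 2 * m) a c.
Proof.
move=> H1 H2; apply: nearW (near_trans (nearMl a (near_sym H1)) (near_trans H2 (nearMr a H1))) _.
lia.
Qed.

(** Collecting the letters of [(a * r) ^+ k] takes fewer than [k ^ 2] transpositions of [a] and [r],
    or none if [k] is 0. *)
Lemma expgM_near n k a r : comm n a r -> near (n * k ^ 2) ((a * r) ^+ k) (a ^+ k * r ^+ k).
Proof.
move=> H; elim: k => [|k IH]; first by apply: nearW (near0 _) _ => //; rewrite mulg1.
rewrite !expgS.
have H2 : near (k * n) (a * r * (a ^+ k * r ^+ k)) (a * a ^+ k * (r * r ^+ k)).
  rewrite -!mulgA; apply: nearMl; rewrite !mulgA; apply: nearMr.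
  exact/commX/comm_sym/H.
by apply: nearW (near_trans (nearMl (a * r) IH) H2) _; nia.
Qed.

(** * Quadratic estimates from seven basic relations *)

Section Relations.
Variables x1 x2 y1 y2 : G.
Let r1 := x1 * y1^-1.
Let r2 := x2 * y2^-1.
Let c := [~ x1, y2].
Let p := r1^-1 * x2 * r1 * x2^-1.

(** With [x_i = (a_i, 1, a_i^-1)] and [y_i = (1, a_i, a_i^-1)], the elements [r1] and [r2] have
    trivial third coordinate, [p] lives in the first factor, and both commutators of [rel_cc] equal
    [[a_1^-1, a_2^-1]] in the third factor. *)
Record rels : Prop := Rels {
  rel_xy1 : comm 1 x1 y1;
  rel_xy2 : comm 1 x2 y2;
  rel_cr1 : comm 1 c r1;
  rel_cr2 : comm 1 c r2;
  rel_yp : comm 1 y2 p;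
  rel_cp : comm 1 c p;
  rel_cc : near 1 c [~ y1, x2] }.

Hypothesis HR : rels.

Lemma xr1 : comm 1 x1 r1.
Proof. exact: (commM (comm_refl x1) (commV (rel_xy1 HR))). Qed.

Lemma xr2 : comm 1 x2 r2.
Proof. exact: (commM (comm_refl x2) (commV (rel_xy2 HR))). Qed.

Lemma yr2 : comm 1 y2 r2.
Proof. exact: (commM (comm_sym (rel_xy2 HR)) (commV (comm_refl y2))). Qed.

(** A form of [[~ x1, y2 ^+ k]] in the letters [c] and [x2] alone, which [[~ y1, x2 ^+ k]] reaches
    as well. *)
Let gam k := (c * x2^-1) ^+ k * x2 ^+ k.

(** In [y2 = r2^-1 * x2] the letter [r2] commutes with [c] and [x2]. Its occurrences are collected
    at quadratic cost, and the two resulting powers cancel. *)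
Lemma commg_gam k : near (3 * k ^ 2) [~ x1, y2 ^+ k] (gam k).
Proof.
have -> : [~ x1, y2 ^+ k] = (c * (x2^-1 * r2)) ^+ k * (r2^-1 * x2) ^+ k.
  rewrite /r2; have -> : c * (x2^-1 * (x2 * y2^-1)) = (y2^-1) ^ x1 by rewrite /c; gsimp.
  have -> : (x2 * y2^-1)^-1 * x2 = y2 by gsimp.
  by rewrite -conjXg expVgn; gsimp.
rewrite mulgA.
have e1 : near (2 * k ^ 2) ((c * x2^-1 * r2) ^+ k) ((c * x2^-1) ^+ k * r2 ^+ k).
  apply: expgM_near; apply: comm_sym.
  by apply: (@commM 1 1); [apply/comm_sym/(rel_cr2 HR)|apply/commV/comm_sym/xr2].
have e2 : near (1 * k ^ 2) ((r2^-1 * x2) ^+ k) (r2^-1 ^+ k * x2 ^+ k).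
  by apply: expgM_near; apply/comm_sym/commV/xr2.
have := nearM e1 e2; rewrite expVgn /gam !mulgA mulgK => H.
by apply: nearW H _; lia.
Qed.

Lemma commg_swap k : near (4 * (k + 1) ^ 2) [~ x1, y2 ^+ k] [~ y1, x2 ^+ k].
Proof.
have H : near k (gam k) [~ y1, x2 ^+ k].
  have -> : [~ y1, x2 ^+ k] = ([~ y1, x2] * x2^-1) ^+ k * x2 ^+ k.
    have -> : [~ y1, x2] * x2^-1 = (x2^-1) ^ y1 by gsimp.
    by rewrite -conjXg expVgn; gsimp.
  apply: nearMr; rewrite -{1}[k]muln1; apply: nearX; apply: nearMr.
  exact: rel_cc HR.
by apply: nearW (near_trans (commg_gam k) H) _; nia.
Qed.

(* [lad j] is a word for [x2 ^+ j * r1 * x2 ^- j] in the letters [r1], [p], [r2],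
   all of which commute with [c]; the step from [j] to [j + 1] has linear cost. *)
Let lad j := r1 * ((p * r2) ^+ j * r2 ^- j).

Lemma lad_step j : near (3 * j) (lad j ^ x2^-1) (lad j.+1).
Proof.
have Hy : comm (3 * j) y2 ((p * r2) ^+ j * r2 ^- j).
  apply: commW (commM (commX j (commM (rel_yp HR) yr2)) (commV (commX j yr2))) _; lia.
move/comm_sym/commV/comm_nearJ: Hy => /(nearJ r2^-1)/(nearMl (r1 * p)).
rewrite -conjgM.
have -> : y2^-1 * r2^-1 = x2^-1 by rewrite /r2; gsimp.
have -> : r1 * p * ((p * r2) ^+ j * r2 ^- j) ^ x2^-1 = lad j ^ x2^-1.
  by rewrite /lad [in RHS]conjMg /p; gsimp.
suff -> : r1 * p * ((p * r2) ^+ j * r2 ^- j) ^ r2^-1 = lad j.+1 by [].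
by rewrite /lad !expgS; gsimp.
Qed.

Lemma c_lad j : comm (3 * j + 1) c (lad j).
Proof.
have cr2 := rel_cr2 HR.
apply: commW (commM (rel_cr1 HR)
  (commM (commX j (commM (rel_cp HR) cr2)) (commV (commX j cr2)))) _; lia.
Qed.

(** Conjugation by [x2^-1] climbs the words [lad j], and conjugation by [(c * x2^-1)^-1] descends
    them, because [c] commutes with each. Every step has linear cost, so the round trip is
    quadratic. *)
Lemma lad_gam k : comm (9 * (k + 1) ^ 2) r1 (gam k).
Proof.
have l0 : lad 0 = r1 by rewrite /lad !expg0 invg1 !mulg1.
have up j : near (3 * j ^ 2) (r1 ^ (x2^-1 ^+ j)) (lad j).
  elim: j => [|j IH]; first by apply: near0; rewrite conjg1.
  rewrite expgSr conjgM; apply: nearW (near_trans (nearJ _ IH) (lad_step j)) _; nia.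
have down j : near (6 * j ^ 2 + j) (lad j ^ ((c * x2^-1)^-1 ^+ j)) r1.
  elim: j => [|j IH]; first by apply: near0; rewrite conjg1.
  have H : near (3 * j + (3 * j + 1)) (lad j.+1 ^ (c * x2^-1)^-1) (lad j).
    rewrite invgM invgK conjgM; apply: near_trans.
      by have := nearJ x2 (lad_step j); rewrite conjgKV => /near_sym/(nearJ c^-1); apply.
    by apply/comm_nearJ/commV/comm_sym/c_lad.
  by rewrite expgS conjgM; apply: nearW (near_trans (nearJ _ H) IH) _; nia.
rewrite -[gam k]invgK; apply/commV/comm_nearJ.
rewrite /gam invgM conjgM -[x2 ^- k]expVgn -[(_ ^+ k)^-1]expVgn.
apply: nearW (near_trans (nearJ _ (up k)) (down k)) _; nia.
Qed.

Lemma r1_commJ k : comm (15 * (k + 1) ^ 2) r1 (x1 ^ (y2 ^+ k)).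
Proof.
have -> : x1 ^ (y2 ^+ k) = x1 * [~ x1, y2 ^+ k] by gsimp.
apply: commW (commM (comm_sym xr1) (comm_near (near_sym (commg_gam k)) (lad_gam k))) _.
nia.
Qed.
End Relations.

(** * Integer powers and squares between edges *)

Definition sgn (e : bool) (x : G) : G := if e then x else x^-1.
Definition zexp (x : G) (n : int) : G := sgn (0 <= n)%R x ^+ absz n.

Lemma zexp1 x (n : int) : zexp x (n + 1)%R = zexp x n * x.
Proof.
rewrite /zexp; case: n => [k|k].
  have -> : (Posz k + 1)%R = Posz k.+1 by lia.
  by rewrite /= expgSr.
case: k => [|k]; first by rewrite /= mulVg.
have -> : (Negz k.+1 + 1)%R = Negz k by lia.
by rewrite /= [in RHS]expgSr mulgVK.
Qed.

Lemma conj_zexp1 w x (n : int) : w ^ zexp x (n + 1)%R = (w ^ zexp x n) ^ x.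
Proof. by rewrite zexp1 conjgM. Qed.

Lemma comm_zexp n a b (k : int) : comm n a b -> comm (absz k * n) a (zexp b k).
Proof. by move=> H; apply: commX; rewrite /sgn; case: ifP => _ //; apply: commV. Qed.

Lemma comm_zexpr x (n : int) : x * zexp x n = zexp x n * x.
Proof.
apply: commuteX; rewrite /sgn; case: ifP => _; first exact: commute_refl.
exact/commuteV/commute_refl.
Qed.

(** The signs reduce integer exponents to powers of a letter or its inverse. The four quadruples
    exchange the first two factors and the two generators. *)
Definition all_rels x1 x2 y1 y2 : Prop := forall e1 e2,
  let X1 := sgn e1 x1 in let X2 := sgn e2 x2 in
  let Y1 := sgn e1 y1 in let Y2 := sgn e2 y2 in
  [/\ rels X1 X2 Y1 Y2, rels X2 X1 Y2 Y1, rels Y1 Y2 X1 X2 & rels Y2 Y1 X2 X1].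

Lemma all_rels_swap x1 x2 y1 y2 : all_rels x1 x2 y1 y2 -> all_rels y1 y2 x1 x2.
Proof. by move=> H e1 e2; case: (H e1 e2). Qed.

Lemma all_rels_index x1 x2 y1 y2 : all_rels x1 x2 y1 y2 -> all_rels x2 x1 y2 y1.
Proof. by move=> H e1 e2; case: (H e2 e1). Qed.

Lemma r_commJ e x1 x2 y1 y2 (k : int) : all_rels x1 x2 y1 y2 ->
  comm (15 * (absz k + 1) ^ 2) (sgn e x1 * (sgn e y1)^-1) (x1 ^ zexp y2 k).
Proof.
move=> /(_ e (0 <= k)%R)[H _ _ _]; have := r1_commJ H (absz k); rewrite -/(zexp y2 k).
by case: e {H} => //= /commV; rewrite conjVg !invgK.
Qed.

Lemma commg_zexp x1 x2 y1 y2 (k : int) : all_rels x1 x2 y1 y2 ->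
  near (4 * (absz k + 1) ^ 2) [~ x1, zexp y2 k] [~ y1, zexp x2 k].
Proof. by move=> /(_ true (0 <= k)%R)[H _ _ _]; apply: commg_swap H _. Qed.

(** Up to quadratic cost [x2 ^ zexp y1 k] is [x2 * y2^-1] times [y2 ^ zexp x1 k], and both of these
    commute with [y2 ^ zexp x1 k]. *)
Lemma commXY x1 x2 y1 y2 (k : int) : all_rels x1 x2 y1 y2 ->
  comm (30 * (absz k + 1) ^ 2) (x2 ^ zexp y1 k) (y2 ^ zexp x1 k).
Proof.
move=> H; have := r_commJ true k (all_rels_index (all_rels_swap H)).
rewrite [sgn _ _]/= => H1.
have := commg_zexp k (all_rels_index H) => H2.
have H3 : near (4 * (absz k + 1) ^ 2) (x2 * y2^-1 * y2 ^ zexp x1 k) (x2 ^ zexp y1 k).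
  have -> : x2 ^ zexp y1 k = x2 * [~ x2, zexp y1 k] by gsimp.
  have -> : x2 * y2^-1 * y2 ^ zexp x1 k = x2 * [~ y2, zexp x1 k] by gsimp.
  exact/near_sym/nearMl.
apply: comm_sym; apply: commW (comm_near H3 (commM (comm_sym _) (comm_refl _))) _.
  by have -> : x2 * y2^-1 = (y2 * x2^-1)^-1; [gsimp|apply: commVl H1].
lia.
Qed.

(* The element [(1, 1, s(h) a_1 s(h + e_1)^-1)], where [s(h) = a_1 ^ h_1 a_2 ^ h_2]. *)
Definition zedge x2 y1 (h : int * int) := [~ zexp x2 h.2, y1] ^ zexp y1 h.1.

Lemma r_comm_zedge0 e x1 x2 y1 y2 (k : int) : all_rels x1 x2 y1 y2 ->
  comm (16 * (absz k + 1) ^ 2) (sgn e x1 * (sgn e y1)^-1) [~ zexp x2 k, y1].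
Proof.
move=> H; have H1 := r_commJ e k (all_rels_swap H).
have -> : [~ zexp x2 k, y1] = (y1 ^ zexp x2 k)^-1 * y1 by gsimp.
have -> : sgn e x1 * (sgn e y1)^-1 = (sgn e y1 * (sgn e x1)^-1)^-1 by gsimp.
apply: commVl; apply: commW (commM (commV H1) (_ : comm 1 _ _)) _; last by lia.
have [_ _ [H2 _ _ _ _ _ _] _] := H e true.
have : comm 1 (sgn e y1 * (sgn e x1)^-1) (sgn e y1).
  by apply/comm_sym/(commM (comm_refl _))/commV.
by case: (e) => //= /commV; rewrite !invgK.
Qed.

(** A step in [h.1] conjugates the third-factor edge by [y1], so the square says that [x1 * y1^-1]
    commutes with this edge. *)
Lemma square_x1 x1 x2 y1 y2 (h : int * int) : all_rels x1 x2 y1 y2 ->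
  near (18 * (absz h.1 + absz h.2 + 1) ^ 2)
    (x1 * zedge x2 y1 (h.1 + 1, h.2)%R) (zedge x2 y1 h * x1).
Proof.
move=> H.
have -> : zedge x2 y1 (h.1 + 1, h.2)%R = zedge x2 y1 h ^ y1 by rewrite /zedge conj_zexp1.
have [[H1 _ _ _ _ _ _] _ _ _] := H true true.
have H2 : comm 1 (x1 * y1^-1) y1 := comm_sym (commM (comm_sym H1) (commV (comm_refl y1))).
have := commJ (r_comm_zedge0 true h.2 H) (comm_zexp h.1 H2); rewrite -/(zedge x2 y1 h).
move: (zedge _ _ _) => z /(nearMr y1); rewrite -!mulgA mulVg mulg1 => H3.
by apply: nearW H3 _; nia.
Qed.

(** An identity valid in every group, so these squares are free of cost. *)
Lemma square_x2 x2 y1 (h : int * int) :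
  x2 ^ zexp y1 h.1 * zedge x2 y1 (h.1, h.2 + 1)%R = zedge x2 y1 h * x2 ^ zexp y1 (h.1 + 1)%R.
Proof.
rewrite /zedge /= conj_zexp1 -!(conjgM, conjMg); set u := zexp y1 _.
rewrite zexp1; set v := zexp x2 _.
suff -> : x2 * [~ v * x2, y1] = [~ v, y1] * x2 ^ y1.
  by rewrite conjMg /u -conjgM comm_zexpr conjgM.
by gsimp.
Qed.

(** The commutators agree at quadratic cost. The conjugators differ by a power of [x1 * y1^-1], up
    to signs, and each of its [absz h.1] letters passes the commutator at quadratic cost; hence the
    cube. *)
Lemma zedge_swap x1 x2 y1 y2 (h : int * int) : all_rels x1 x2 y1 y2 ->
  near (22 * (absz h.1 + absz h.2 + 1) ^ 3) (zedge x2 y1 h) (zedge y2 x1 h).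
Proof.
move=> H; rewrite /zedge; set w := [~ _, y1]; set w' := [~ _, x1].
have Hw : near (4 * (absz h.2 + 1) ^ 2) w w'.
  by have /nearV := commg_zexp h.2 (all_rels_swap H); rewrite !invgR.
set e := (0 <= h.1)%R; set rr := sgn e x1 * (sgn e y1)^-1.
have Hr : comm (16 * (absz h.2 + 1) ^ 2) rr w by apply: r_comm_zedge0 H.
have [[H1 _ _ _ _ _ _] _ _ _] := H e true.
have Hry : comm 1 rr (sgn e y1) := comm_sym (commM (comm_sym H1) (commV (comm_refl _))).
have H2 : near (1 * absz h.1 ^ 2) (zexp x1 h.1) (rr ^+ absz h.1 * zexp y1 h.1).
  have := expgM_near (absz h.1) Hry; rewrite /rr mulgVK; exact.
have H3 := nearJr w H2; rewrite conjgM in H3.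
have /comm_nearJ/(nearJ (zexp y1 h.1)) H4 := commX (absz h.1) (comm_sym Hr).
apply: nearW (near_trans (near_sym H4) (near_trans (near_sym H3) (nearJ _ Hw))) _.
nia.
Qed.
End Cost.

(** * Paths of edges and their sorting *)

Definition edge_type : eqType := ('I_3 * 'I_2)%type.

Definition height := (int * int)%type.

(** The factor is ignored: the standard homomorphism is the sum of the three abelianizations. *)
Definition move (h : height) (x : edge_type * bool) : height :=
  let d : int := if x.2 then 1%R else (-1)%R in
  if val x.1.2 == 0 then (h.1 + d, h.2)%R else (h.1, h.2 + d)%R.

Definition hsize (h : height) := absz h.1 + absz h.2.

Lemma hsize_move h x : hsize (move h x) <= hsize h + 1.
Proof. by rewrite /hsize /move; case: ifP => _ /=; case: x.2; lia. Qed.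

Lemma moveK h x : move (move h x) (linv x) = h.
Proof.
rewrite /move; case: x => [[t i] b]; case: h => h1 h2 /=.
by case: b => /=; case: (i == 0 :> nat) => /=; congr pair; lia.
Qed.

Lemma moveC h x y : move (move h x) y = move (move h y) x.
Proof.
rewrite /move; case: x => [[t i] b]; case: y => [[t' j] b']; case: h => h1 h2 /=.
by case: (i == 0 :> nat); case: (j == 0 :> nat); case: b; case: b' => /=; congr pair; lia.
Qed.

Definition final := foldl move.

Definition proj (T : 'I_3) (w : word edge_type) : word 'I_2 :=
  [seq (x.1.2, x.2) | x <- w & x.1.1 == T].

Section Walk.
Local Open Scope group_scope.
Variables (G : groupType) (A : nat -> G -> Prop).
Hypothesis HA : area_norm A.

Section Edges.
Variable edge : edge_type -> height -> G.
Implicit Types (w u v : word edge_type) (h : height).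

(** A backward letter reads the inverse of the edge that starts where the letter arrives. *)
Definition label h x := if x.2 then edge x.1 h else (edge x.1 (move h x))^-1.
Definition walk (s : height * G) x := (move s.1 x, s.2 * label s.1 x).
Definition real h w : G := (foldl walk (h, 1) w).2.

Lemma label_linv h x : label (move h x) (linv x) = (label h x)^-1.
Proof.
case: x => t []; last by rewrite /label /= invgK.
by rewrite /label /= moveK.
Qed.

Lemma walkK s x : walk (walk s x) (linv x) = s.
Proof. by case: s => h g; rewrite /walk /= moveK label_linv mulgK. Qed.

Lemma foldl_walk h g w : foldl walk (h, g) w = (final h w, g * real h w).
Proof.
rewrite /real; elim: w h g => [|x w IH] h g /=; first by rewrite mulg1.
rewrite [walk _ x]/= [walk (h, 1) x]/= (IH _ (g * _)) (IH _ (1 * _)).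
by rewrite /= mul1g mulgA.
Qed.

Lemma real_cons h x w : real h (x :: w) = label h x * real (move h x) w.
Proof. by rewrite {1}/real /= {2}/walk mul1g foldl_walk. Qed.

Lemma real_cat h u v : real h (u ++ v) = real h u * real (final h u) v.
Proof. by rewrite {1}/real foldl_cat foldl_walk foldl_walk mul1g. Qed.

(** Letters of one factor act on pairs of height and value with inverse letters cancelling, so
    freely trivial words act trivially. *)
Lemma real_proj T w h : {in w, forall x, x.1.1 = T} -> freduce (proj T w) = [::] ->
  final h w = h /\ real h w = 1.
Proof.
move=> HT Hr; pose act s (x : 'I_2 * bool) := walk s ((T, x.1), x.2).
have actK s x : act (act s x) (linv x) = s by rewrite /act walkK.
have E : foldl walk (h, 1) w = foldl act (h, 1) (proj T w).
  elim: w (h, 1) HT {Hr} => [//|x w IH] s HT /=.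
  rewrite /proj /= (HT x) ?mem_head // eqxx /= -/(proj T w) IH => [|y Hy]; last by apply: HT; rewrite inE Hy orbT.
  by rewrite /act /= -(HT x) ?mem_head //; case: x {HT} => [[? ?] ?].
have := foldl_walk h 1 w; rewrite E -(act_freduce actK) Hr mul1g.
by case=> <- <-.
Qed.

Section Sorting.
Variables (P Q : pred edge_type) (K B : nat).
Hypothesis square : forall t t' h, P t -> Q t' -> ~~ P t' -> hsize h <= B ->
  near A K (edge t h * edge t' (move h (t, true))) (edge t' h * edge t (move h (t', true))).

(** Whatever the signs, the two letters span one square. The hypothesis is applied at the corner
    from which both of its edges leave forwards, of size at most [hsize h + 2]. *)
Lemma label_swap h x y : P x.1 -> Q y.1 -> ~~ P y.1 -> hsize h + 2 <= B ->
  near A K (label h y * label (move h y) x) (label h x * label (move h x) y).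
Proof.
case: x y => [t []] [t' []] /= Pt Qt Pt' Hh; rewrite /label /=.
- apply/(near_sym HA); apply: square => //; lia.
- set b := move h (t', false).
  have hE : h = move b (t', true) by rewrite /b -[(t', true)]/(linv (t', false)) moveK.
  rewrite (_ : move (move h (t, true)) (t', false) = move b (t, true)); last by rewrite moveC.
  rewrite {1}hE; have Hb : hsize b <= B by have := hsize_move h (t', false); rewrite -/b; lia.
  have := square Pt Qt Pt' Hb; set a := edge t b; set c := edge _ (move b (t, true)).
  set a' := edge t' b; set c' := edge t _ => /(nearMl HA a'^-1)/(nearMr HA c^-1).
  by gsimp.
- set b := move h (t, false).
  have hE : h = move b (t, true) by rewrite /b -[(t, true)]/(linv (t, false)) moveK.
  rewrite (_ : move (move h (t', true)) (t, false) = move b (t', true)); last by rewrite moveC.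
  rewrite {1}hE; have Hb : hsize b <= B by have := hsize_move h (t, false); rewrite -/b; lia.
  have := square Pt Qt Pt' Hb; set a := edge t b; set c := edge _ (move b (t, true)).
  set a' := edge t' b; set c' := edge t _ => /(nearMl HA a^-1)/(nearMr HA c'^-1).
  by gsimp.
- set b := move (move h (t', false)) (t, false).
  have e1 : move h (t, false) = move b (t', true).
    by rewrite /b moveC -[(t', true)]/(linv (t', false)) moveK.
  have e2 : move h (t', false) = move b (t, true).
    by rewrite /b -[(t, true)]/(linv (t, false)) moveK.
  rewrite -(moveC h) -/b {1}e1 {1}e2.
  have Hb : hsize b <= B.
    have := hsize_move (move h (t', false)) (t, false).
    by have := hsize_move h (t', false); rewrite -/b; lia.
  have := square Pt Qt Pt' Hb => /(nearV HA)/(near_sym HA).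
  by rewrite !invgM => /(near_sym HA).
Qed.

Lemma real_move h u y v : {in u, forall x, P x.1} -> Q y.1 -> ~~ P y.1 ->
  hsize h + size u + 1 <= B ->
  near A (size u * K) (real h (y :: u ++ v)) (real h (u ++ y :: v)).
Proof.
elim: u h => [|x u IH] h HP Qy Py Hh; first exact: near0.
have {}Hh : hsize h + (size u).+1 + 1 <= B by [].
rewrite [y :: _]/= [(x :: u) ++ _]/= [size _]/= !real_cons !mulgA.
have Px : P x.1 by apply: HP; rewrite mem_head.
have H1 : hsize h + 2 <= B by lia.
have {}HP : {in u, forall x, P x.1} by move=> z Hz; apply: HP; rewrite inE Hz orbT.
have H2 : hsize (move h x) + size u + 1 <= B.
  by rewrite -addnA; apply: leq_trans (leq_add (hsize_move h x) (leqnn _)) _; lia.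
have := nearMr HA (real (move (move h y) x) (u ++ v)) (label_swap Px Qy Py H1).
have := nearMl HA (label h x) (IH _ HP Qy Py H2).
rewrite real_cons (moveC h y x) !mulgA => H3 H4.
by apply: (nearW HA (near_trans HA H4 H3) _); rewrite ?mulSn.
Qed.

(** Insertion sort: each letter outside [P] moves past the [P] letters to its right, so at most
    [size w ^ 2] squares are crossed. *)
Lemma real_sort h w : {in w, forall x, P x.1 || Q x.1} -> hsize h + size w + 1 <= B ->
  near A (size w ^ 2 * K) (real h w)
    (real h ([seq x <- w | P x.1] ++ [seq x <- w | ~~ P x.1])).
Proof.
elim: w h => [|x w IH] h HQ Hh; first exact: near0.
have {}HQ' : {in w, forall x, P x.1 || Q x.1} by move=> z Hz; apply: HQ; rewrite inE Hz orbT.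
have {}Hh : hsize h + (size w).+1 + 1 <= B by [].
have Hh' : hsize (move h x) + size w + 1 <= B.
  by rewrite -addnA; apply: leq_trans (leq_add (hsize_move h x) (leqnn _)) _; lia.
have H1 := nearMl HA (label h x) (IH _ HQ' Hh'); rewrite -!real_cons in H1.
rewrite [size _]/= [filter _ (x :: w)]/= [X in _ ++ X]/=.
case Px: (P x.1) => /=; first by apply: (nearW HA H1 _); rewrite leq_mul2r leq_exp2r // leqnSn orbT.
have Qx : Q x.1 by have := HQ x (mem_head _ _); rewrite Px.
have Hs : (size [seq x <- w | P x.1] <= size w)%N by rewrite size_filter count_size.
have Hu : {in [seq x <- w | P x.1], forall x, P x.1} by move=> z; rewrite mem_filter => /andP[].
have := @real_move h _ x [seq x <- w | ~~ P x.1] Hu Qx (negbT Px) _ => H2.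
have sq n m : (m <= n -> n ^ 2 + m <= n.+1 ^ 2)%N by nia.
apply: (nearW HA (near_trans HA H1 (H2 _)) _); last by rewrite -mulnDl; apply/leq_mul/leqnn/sq.
by apply: leq_trans Hh; rewrite leq_add2r leq_add2l ltnW // ltnS.
Qed.
End Sorting.
End Edges.

Lemma real_convert (edge edge' : edge_type -> height -> G) K B :
  (forall t h, hsize h <= B -> near A K (edge t h) (edge' t h)) ->
  forall w h, hsize h + size w <= B -> near A (size w * K) (real edge h w) (real edge' h w).
Proof.
move=> H; elim=> [|x w IH] h Hh; first exact: near0.
have {}Hh : hsize h + (size w).+1 <= B by [].
have Hm := hsize_move h x.
rewrite !real_cons [size _]/= mulSn; apply: nearM => //; last first.
  by apply: IH; apply: leq_trans (leq_add Hm (leqnn _)) _; lia.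
rewrite /label; case: x.2; first by apply: H; lia.
apply: (nearV HA); apply: H; apply: leq_trans Hm _; lia.
Qed.
End Walk.

(** * Pushing *)

Definition gen : finType := (bool * 'I_2)%type.

Definition fac0 : 'I_3 := @Ordinal 3 0 isT.
Definition fac1 : 'I_3 := @Ordinal 3 1 isT.
Definition fac2 : 'I_3 := @Ordinal 3 2 isT.

(** [x_i] is a first-factor edge followed by a backward third-factor edge, and [y_i] likewise starts
    in the second factor, so the height returns to its start after each generator. *)
Definition split_letter (x : gen * bool) : word edge_type :=
  let t : edge_type := (if x.1.1 then fac0 else fac1, x.1.2) in
  let z : edge_type := (fac2, x.1.2) in
  if x.2 then [:: (t, true); (z, false)] else [:: (z, true); (t, false)].

Definition split_word (w : word gen) : word edge_type := flatten (map split_letter w).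

Lemma size_split_word w : size (split_word w) = (2 * size w)%N.
Proof.
elim: w => [//|x w IH]; rewrite /split_word /= size_cat -/(split_word w) IH /split_letter.
by case: x.2 => /=; lia.
Qed.

Section Push.
Local Open Scope group_scope.
Variables (G : groupType) (A : nat -> G -> Prop).
Hypothesis HA : area_norm A.
Variables (x1 x2 y1 y2 : G).
Hypothesis HR : all_rels A x1 x2 y1 y2.

Definition gen_val (s : gen) : G :=
  match s.1, val s.2 with
  | true, 0 => x1 | true, _ => x2 | false, 0 => y1 | false, _ => y2
  end.

(* The flag selects one of two words for the edge of the third factor: the first
   makes squares with the first factor cheap, the second those with the second factor. *)
Definition edge (f : bool) (t : edge_type) (h : height) : G :=
  match val t.1, val t.2 with
  | 0, 0 => x1 | 0, _ => x2 ^ zexp y1 h.1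
  | 1, 0 => y1 | 1, _ => y2 ^ zexp x1 h.1
  | _, 0 => if f then zedge x2 y1 h else zedge y2 x1 h
  | _, _ => 1
  end.

Lemma zexp0 x : zexp x 0 = 1 :> G.
Proof. by rewrite /zexp. Qed.

Lemma edge_origin f t : edge f t (0, 0)%R =
  if val t.1 == 2 then 1 else gen_val (val t.1 == 0, t.2).
Proof.
case: t => [[[|[|[|//]]] hT] [[|[|//]] hi]]; rewrite /edge /gen_val //= ?zexp0 ?conjg1 //.
by case: f; rewrite /zedge /= !zexp0 comm1g conjg1.
Qed.

(** At the origin third-factor edges are trivial and the other edges are the generators
    themselves. *)
Lemma real_split f w : final (0, 0)%R (split_word w) = (0, 0)%R /\
  real (edge f) (0, 0)%R (split_word w) = ev gen_val w.
Proof.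
elim: w => [//|x w [IH1 IH2]].
suff [E1 E2] : final (0, 0)%R (split_letter x) = (0, 0)%R /\
    real (edge f) (0, 0)%R (split_letter x) = ev_letter gen_val x.
  rewrite /split_word /= -/(split_word w) real_cat {1}/final foldl_cat.
  by rewrite -!/(final _ _) E1 E2 IH1 IH2.
case: x => [[b i] e]; split.
  by rewrite /final; case: e => /=; rewrite /move /=; case: (i == 0 :> nat).
have Z (z : edge_type) : z.1 = fac2 -> edge f z (0, 0)%R = 1 by rewrite edge_origin => ->.
have H (z : edge_type) : z.1 = (if b then fac0 else fac1) -> z.2 = i ->
    edge f z (0, 0)%R = gen_val (b, i).
  by rewrite edge_origin => -> ->; case: (b).
rewrite /split_letter /ev_letter /=; case: e; rewrite !real_cons /label /=.
  rewrite H // -[X in edge f (fac2, i) X]/(move (move (0, 0)%R (fac0, i, true)) (linv (fac0, i, true))).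
  by rewrite moveK Z // invg1 /real /= !mulg1.
rewrite Z // mul1g -[X in edge f _ X]/(move (move (0, 0)%R (fac0, i, true)) (linv (fac0, i, true))).
by rewrite moveK H // /real /= !mulg1.
Qed.

Let cost B := (30 * (B + 1) ^ 2)%N.

Lemma square_first B (t t' : edge_type) h : val t.1 == 0 -> val t'.1 != 0 -> hsize h <= B ->
  near A (cost B) (edge true t h * edge true t' (move h (t, true)))
    (edge true t' h * edge true t (move h (t', true))).
Proof.
rewrite /cost /hsize; case: t t' => [[[|//] hT] [i hi]] [[[//|T'] hT'] [j hj]] _ _ Hh.
have [[H1 _ _ _ _ _ _] _ _ _] := HR true true.
case: T' i j hT' hi hj => [|[|//]] [|[|//]] [|[|//]] hT' hi hj; rewrite /edge /move /= ?conj_zexp1.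
- by apply: (nearW HA H1 _); lia.
- by apply: (nearW HA (near0 HA _) _) => //; gsimp.
- by apply: (nearW HA (near0 HA _) _) => //; gsimp.
- by apply: (nearW HA (commXY HA h.1 HR) _); nia.
- by apply: (nearW HA (square_x1 HA h HR) _); nia.
- by apply: (nearW HA (near0 HA _) _) => //; gsimp.
- by rewrite -conj_zexp1 -square_x2; apply: (nearW HA (near0 HA _) _).
- by apply: (nearW HA (near0 HA _) _) => //; gsimp.
Qed.

Lemma square_second B (t t' : edge_type) h : val t.1 == 1%N -> val t'.1 == 2 -> hsize h <= B ->
  near A (cost B) (edge false t h * edge false t' (move h (t, true)))
    (edge false t' h * edge false t (move h (t', true))).
Proof.
rewrite /cost /hsize.
case: t t' => [[[|[|//]] hT] [i hi]] // [[[|[|[|//]]] hT'] [j hj]] // _ _ Hh.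
case: i j hi hj => [|[|//]] [|[|//]] hi hj; rewrite /edge /move /=.
- by apply: (nearW HA (square_x1 HA h (all_rels_swap HR)) _); nia.
- by apply: (nearW HA (near0 HA _) _) => //; gsimp.
- by rewrite -square_x2; apply: (nearW HA (near0 HA _) _).
- by apply: (nearW HA (near0 HA _) _) => //; gsimp.
Qed.

Lemma edge_convert B (t : edge_type) h : hsize h <= B ->
  near A (22 * (B + 1) ^ 3) (edge true t h) (edge false t h).
Proof.
rewrite /hsize => Hh.
case: t => [[[|[|[|//]]] hT] [[|[|//]] hi]]; rewrite /edge /=;
  try by apply: (nearW HA (near0 HA (erefl _)) _).
apply: (nearW HA (zedge_swap HA h HR) _); rewrite leq_mul2l leq_exp2r //; lia.
Qed.

Lemma proj_filter (T : 'I_3) (P : pred edge_type) (w : word edge_type) :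
  (forall t, t.1 = T -> P t) -> proj T [seq x <- w | P x.1] = proj T w.
Proof.
move=> H; rewrite /proj -filter_predI; congr map; apply: eq_filter => x /=.
by case: eqP => //= /H.
Qed.

Theorem push_area (w : word gen) : (forall T, freduce (proj T (split_word w)) = [::]) ->
  A (10000 * (size w + 1) ^ 4) (ev gen_val w).
Proof.
move=> Hw; have [_ <-] := real_split true w; set o : height := (0, 0)%R.
set W := split_word w; set n := size w.
have sW : size W = (2 * n)%N by apply: size_split_word.
(* The path has [2 * n] letters and starts at height zero; [real_sort] asks for one unit more. *)
set B := (2 * n + 1)%N.
pose P0 (t : edge_type) := val t.1 == 0; pose P1 (t : edge_type) := val t.1 == 1%N.
pose P2 (t : edge_type) := val t.1 == 2.
set X := [seq x <- W | P0 x.1]; set V := [seq x <- W | ~~ P0 x.1].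
set Y := [seq x <- V | P1 x.1]; set Z := [seq x <- V | ~~ P1 x.1].
have sV : size V <= 2 * n by rewrite -sW size_filter count_size.
have [fX rX] : final o X = o /\ real (edge true) o X = 1.
  apply: (@real_proj _ _ fac0) => [x|].
    by rewrite mem_filter => /andP[/eqP H _]; apply: val_inj.
  by rewrite (@proj_filter _ P0) // => t; rewrite /P0 => ->.
have [fY rY] : final o Y = o /\ real (edge false) o Y = 1.
  apply: (@real_proj _ _ fac1) => [x|].
    by rewrite mem_filter => /andP[/eqP H _]; apply: val_inj.
  rewrite (@proj_filter _ P1) => [|t]; last by rewrite /P1 => ->.
  by rewrite (@proj_filter _ (predC P0)) // => t; rewrite /P0 /= => ->.
have rZ : real (edge false) o Z = 1.
  apply: proj2; apply: (@real_proj _ _ fac2) => [x|].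
    rewrite !mem_filter /P0 /P1 => /and3P[H1 H2 _]; apply: val_inj => /=.
    by case: (x.1.1) H1 H2 => [[|[|[|//]]] hT].
  rewrite (@proj_filter _ (predC P1)) => [|t]; last by rewrite /P1 /= => ->.
  by rewrite (@proj_filter _ (predC P0)) // => t; rewrite /P0 /= => ->.
(* Once sorted to the front, the first factor forms a closed path [X] of value 1 and disappears. *)
have H1 : near A ((2 * n) ^ 2 * cost B) (real (edge true) o W) (real (edge true) o V).
  have := @real_sort _ A HA (edge true) P0 (predC P0) (cost B) B _ o W _ _.
  rewrite real_cat -/X -/V fX rX mul1g sW; apply => [t t' h Pt _ Pt' Hh|x _|].
  - exact: square_first.
  - by rewrite /= orbN.
  - by rewrite /hsize /o /=; lia.
have H2 : near A (2 * n * (22 * (B + 1) ^ 3)) (real (edge true) o V) (real (edge false) o V).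
  apply: (nearW HA (real_convert HA (@edge_convert B) _) _) => //.
    exact: leq_trans sV (leq_addr 1 _).
  by rewrite leq_mul2r sV orbT.
have H3 : near A ((2 * n) ^ 2 * cost B) (real (edge false) o V) 1.
  have := @real_sort _ A HA (edge false) P1 P2 (cost B) B _ o V _ _.
  rewrite real_cat -/Y -/Z fY rY rZ mul1g => H.
  apply: (nearW HA (H _ _ _) _).
  - by move=> t t' h H1' H2' _; apply: square_second.
  - move=> x; rewrite mem_filter /P0 /P1 /P2 => /andP[H1' _].
    by case: (x.1.1) H1' => [[|[|[|//]]] hT].
  - by rewrite leq_add2r.
  - by rewrite leq_mul2r leq_exp2r // sV orbT.
have := near_trans HA H1 (near_trans HA H2 H3); rewrite /near invg1 mulg1.
apply: (normW HA) => //; rewrite /cost /B.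
rewrite (_ : 2 * n + 1 + 1 = 2 * (n + 1))%N; last by lia.
move: (n + 1)%N (leq_addr 1 n) => m le.
have e2 : ((2 * n) ^ 2 <= 4 * m ^ 2)%N by rewrite expnMn leq_mul2l leq_exp2r.
rewrite !expnMn.
have e4 : (m ^ 4 = m ^ 2 * m ^ 2)%N by rewrite -expnD.
have e3 : (m ^ 4 = m * m ^ 3)%N by rewrite -expnS.
(* The two sorts contribute 480 each and the change of words 352; the remainder is slack. *)
rewrite (_ : 10000 = 960 + 352 + 8688)%N // !mulnDl.
nia.
Qed.
End Push.

(** * The standard presentation *)

Section AreaNorm.
Local Open Scope group_scope.
Variables (S : finType) (R : seq (word S)).

Definition pval (p : word S * word S * bool) : free_group S :=
  (sgn p.2 (fgw p.1.2)) ^ fgw p.1.1.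
Definition pprod (l : seq (word S * word S * bool)) : free_group S :=
  foldr (fun p g => pval p * g) 1 l.

Lemma pprod_cat l l' : pprod (l ++ l') = pprod l * pprod l'.
Proof. by elim: l => [|p l IH] /=; rewrite ?mul1g // IH mulgA. Qed.

Lemma fgw_conj_rel (p : word S * word S * bool) :
  fgw (conj_rel p.1.1 (if p.2 then p.1.2 else winv p.1.2)) = pval p.
Proof.
by rewrite /conj_rel !fgw_cat fgw_winv /pval /sgn; case: p.2; rewrite ?fgw_winv.
Qed.

Lemma area_leP w M : area_le R w M <-> exists l,
  [/\ size l <= M, forall p, p \in l -> p.1.2 \in R & fgw w = pprod l].
Proof.
have E l : fgw (flatten [seq conj_rel p.1.1 (if p.2 then p.1.2 else winv p.1.2) | p <- l])
    = pprod l.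
  by elim: l => [//|p l IH]; rewrite /= fgw_cat IH fgw_conj_rel.
split=> [[l [H1 [H2 H3]]]|[l [H1 H2 H3]]]; exists l.
  by split=> //; rewrite -E; apply/fgwP.
by do !split=> //; apply/fgwP; rewrite E.
Qed.

Definition cost (n : nat) (g : free_group S) : Prop := area_le R (fval g) n.

Lemma cost_fgw n w : cost n (fgw w) <-> area_le R w n.
Proof. by rewrite /cost !area_leP fgw_val. Qed.

Lemma cost_norm : area_norm cost.
Proof.
split; rewrite /cost.
- by apply/area_leP; exists [::].
- move=> m n g h /area_leP[l [H1 H2 H3]] /area_leP[l' [H1' H2' H3']].
  apply/area_leP; exists (l ++ l'); split; first by rewrite size_cat leq_add.
    by move=> p; rewrite mem_cat => /orP[/H2|/H2'].
  by rewrite pprod_cat -H3 -H3' !fgw_val.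
- move=> n g /area_leP[l [H1 H2 H3]]; apply/area_leP.
  exists (rev [seq (p.1, ~~ p.2) | p <- l]); split; first by rewrite size_rev size_map.
    by move=> p; rewrite mem_rev => /mapP[q /H2 Hq ->].
  rewrite fgw_val -(fgw_val g) H3; elim: (l) => [|p k IH]; first by rewrite invg1.
  rewrite /= rev_cons -cats1 pprod_cat -IH invgM /= mulg1; congr (_ * _).
  by rewrite /pval -conjVg /=; case: p.2 => //=; rewrite invgK.
- move=> n g h /area_leP[l [H1 H2 H3]]; apply/area_leP.
  exists [seq (p.1.1 ++ fval h, p.1.2, p.2) | p <- l]; split; first by rewrite size_map.
    by move=> p /mapP[q /H2 Hq ->].
  rewrite fgw_val -(fgw_val g) H3; elim: (l) => [|p k IH]; first by rewrite conj1g.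
  by rewrite /= conjMg -IH /pval fgw_cat fgw_val conjgM.
- move=> m n g mn /area_leP[l [H1 H2 H3]]; apply/area_leP; exists l; split=> //.
  exact: leq_trans mn.
Qed.

Lemma cost_relator r : r \in R -> cost 1 (fgw r).
Proof.
move=> Hr; apply/cost_fgw/area_leP; exists [:: ([::], r, true)]; split=> //.
  by move=> p; rewrite inE => /eqP->.
by rewrite /= /pval /= conjg1 mulg1.
Qed.

Lemma ev_relators (H : groupType) (f : S -> H) :
  (forall r, r \in R -> ev f r = 1) -> forall w, null_hom R w -> ev f w = 1.
Proof.
move=> HR w [M [l [_ [Hl Hw]]]]; rewrite (ev_freeeq _ Hw).
elim: l Hl {Hw} => [//|p l IH] Hl; rewrite /= ev_cat IH; last first.
  by move=> q Hq; apply: Hl; rewrite inE Hq orbT.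
have Hp := HR _ (Hl p (mem_head _ _)).
rewrite mulg1 /conj_rel !ev_cat ev_winv.
by case: p.2; rewrite ?ev_winv Hp ?invg1 mul1g mulVg.
Qed.
End AreaNorm.

Section StandardPresentation.

Definition commutation (S : eqType) (u v : word S) := u ++ v ++ winv (v ++ u).

(** The relations of [rels] in the same order, read off by position in [base_rels]. *)
Definition base_relators (S : eqType) (x1 x2 y1 y2 : word S) : seq (word S) :=
  let r1 := x1 ++ winv y1 in let r2 := x2 ++ winv y2 in
  let c := winv x1 ++ winv y2 ++ x1 ++ y2 in
  let p := winv r1 ++ x2 ++ r1 ++ winv x2 in
  [:: commutation x1 y1; commutation x2 y2; commutation c r1; commutation c r2;
      commutation y2 p; commutation c p; c ++ winv (winv y1 ++ winv x2 ++ y1 ++ x2)].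

Definition signed (e : bool) (u : word gen) := if e then u else winv u.

Definition gw (b : bool) (i : 'I_2) : word gen := [:: ((b, i), true)].

Definition idx0 : 'I_2 := @Ordinal 2 0 isT.
Definition idx1 : 'I_2 := @Ordinal 2 1 isT.

Definition sym_relators (e1 e2 : bool) : seq (word gen) :=
  let x1 := signed e1 (gw true idx0) in let x2 := signed e2 (gw true idx1) in
  let y1 := signed e1 (gw false idx0) in let y2 := signed e2 (gw false idx1) in
  base_relators x1 x2 y1 y2 ++ base_relators x2 x1 y2 y1 ++
  base_relators y1 y2 x1 x2 ++ base_relators y2 y1 x2 x1.

(** Sixteen copies of the seven relators, one for each sign choice and each quadruple of
    [all_rels]. *)
Definition relators : seq (word gen) :=
  flatten [:: sym_relators true true; sym_relators true false;
              sym_relators false true; sym_relators false false].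

Lemma base_rels (S : finType) (R : seq (word S)) x1 x2 y1 y2 :
  {subset base_relators x1 x2 y1 y2 <= R} ->
  rels (cost R) (fgw x1) (fgw x2) (fgw y1) (fgw y2).
Proof.
move=> sub.
have M n : n < 7 -> cost R 1 (fgw (nth [::] (base_relators x1 x2 y1 y2) n)).
  by move=> Hn; apply/cost_relator/sub/mem_nth.
have E (u v : word S) : fgw (commutation u v) = (fgw u * fgw v * (fgw v * fgw u)^-1)%g.
  by rewrite /commutation !fgw_cat fgw_winv fgw_cat mulgA.
split; rewrite /comm /near.
- have := M 0 isT; rewrite /= E; exact.
- have := M 1%N isT; rewrite /= E; exact.
- by have := M 2 isT; rewrite /= E /commg /conjg !(fgw_cat, fgw_winv) !mulgA.
- by have := M 3 isT; rewrite /= E /commg /conjg !(fgw_cat, fgw_winv) !mulgA.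
- by have := M 4 isT; rewrite /= E /commg /conjg !(fgw_cat, fgw_winv) !mulgA.
- by have := M 5 isT; rewrite /= E /commg /conjg !(fgw_cat, fgw_winv) !mulgA.
- by have := M 6 isT; rewrite /= /commg /conjg !(fgw_cat, fgw_winv) !mulgA.
Qed.

Definition fgen (b : bool) (i : 'I_2) : free_group gen := fgw (gw b i).

Lemma all_rels_relators :
  all_rels (cost relators) (fgen true idx0) (fgen true idx1) (fgen false idx0) (fgen false idx1).
Proof.
move=> e1 e2 /=.
have E e b i : sgn e (fgen b i) = fgw (signed e (gw b i)) by case: e => //=; rewrite fgw_winv.
have sub : {subset sym_relators e1 e2 <= relators}.
  move=> r Hr; apply/flattenP; exists (sym_relators e1 e2) => //.
  by case: e1 e2 {Hr} => [] []; rewrite !(in_cons, eqxx, orbT).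
rewrite !E; split; apply: base_rels => r Hr; apply: sub; rewrite /sym_relators !mem_cat Hr ?orbT //.
Qed.

Definition std_gen (s : gen) : triple := fun j =>
  if j == (if s.1 then fac0 else fac1) then [:: (s.2, true)]
  else if j == fac2 then [:: (s.2, false)] else [::].

Lemma fgw_teval (S : choiceType) (psi : S -> triple) (w : word S) j :
  fgw (teval psi w j) = ev (fun s => fgw (psi s j)) w.
Proof.
elim: w => [//|[s b] w IH]; rewrite /= /tmul fgw_cat IH; congr (_ * _)%g.
by case: b; rewrite /ev_letter //= /tinv fgw_winv.
Qed.

Lemma teval_std w j : teval std_gen w j = proj j (split_word w).
Proof.
elim: w => [//|[[b i] e] w IH].
rewrite /split_word /= /proj filter_cat map_cat -/(split_word w) -/(proj _ _) /tmul IH.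
congr (_ ++ _); case: j {IH} => [[|[|[|//]]] hj]; by case: b; case: e.
Qed.

Lemma eq_ev (S : choiceType) (G : groupType) (f g : S -> G) : f =1 g -> ev f =1 ev g.
Proof. by move=> E; elim=> [//|x w IH] /=; rewrite IH /ev_letter E. Qed.

Lemma gen_val_fgw (w : word gen) :
  ev (gen_val (fgen true idx0) (fgen true idx1) (fgen false idx0) (fgen false idx1)) w = fgw w.
Proof.
rewrite -ev_fgw; apply: eq_ev => -[b i]; rewrite /gen_val /fgen /gw /=.
have -> : i = if i == idx0 then idx0 else idx1.
  by case: i => [[|[|//]] hi]; apply: val_inj.
by case: eqP; case: b.
Qed.

(** The hypothesis is triviality in the product of free groups, so this both bounds areas and shows
    that the relators suffice. *)
Lemma std_upper w : teq (teval std_gen w) tone ->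
  area_le relators w (10000 * (size w + 1) ^ 4).
Proof.
move=> Hw; apply/cost_fgw; rewrite -gen_val_fgw.
apply: (push_area (cost_norm relators) all_rels_relators (w := w)) => T.
by have := Hw T; rewrite /freeeq teval_std.
Qed.

Lemma std_sound w : null_hom relators w -> teq (teval std_gen w) tone.
Proof.
move=> Hw j; apply/fgwP; rewrite fgw_teval; apply: ev_relators Hw => r Hr.
rewrite -fgw_teval -fgw_nil; apply/fgwP/eqP; move: r Hr; apply/allP.
by case: j => [[|[|[|//]]] hj]; vm_compute.
Qed.

(** * Generation of the standard kernel *)

Definition lift_word (T : 'I_3) (u : word 'I_2) : word edge_type :=
  [seq ((T, y.1), y.2) | y <- u].

Lemma proj_lift_word T j u : proj j (lift_word T u) = if T == j then u else [::].
Proof.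
rewrite /proj filter_map -map_comp; case: ifP => E.
  rewrite (eq_filter (a2 := predT)) ?filter_predT; last by move=> y /=; rewrite E.
  by rewrite -[RHS]map_id; apply: eq_map => -[].
by rewrite (eq_filter (a2 := pred0)) ?filter_pred0 // => y /=; rewrite E.
Qed.

Definition triple_word (x : triple) : word edge_type :=
  lift_word fac0 (x fac0) ++ lift_word fac1 (x fac1) ++ lift_word fac2 (x fac2).

Lemma proj_triple_word x j : proj j (triple_word x) = x j.
Proof.
rewrite /triple_word /proj !filter_cat !map_cat -!/(proj _ _) !proj_lift_word.
case: j => [[|[|[|//]]] hj]; rewrite /= ?cats0; congr (x _); exact: val_inj.
Qed.

Section EdgeMorphism.
Local Open Scope group_scope.
Variables (G H : groupType) (f : G -> H).
Hypotheses (fM : {morph f : g h / g * h}) (f1 : f 1 = 1) (fV : {morph f : g / g^-1}).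

Lemma morph_zexp g n : f (zexp g n) = zexp (f g) n.
Proof.
have fX k h : f (h ^+ k) = f h ^+ k by elim: k => [//|k IH]; rewrite !expgS fM IH.
by rewrite /zexp fX; case: (0 <= n)%R; rewrite /sgn ?fV.
Qed.

Lemma morph_edge x1 x2 y1 y2 e t h :
  f (edge x1 x2 y1 y2 e t h) = edge (f x1) (f x2) (f y1) (f y2) e t h.
Proof.
have fJ u v : f (u ^ v) = f u ^ f v by rewrite /conjg !fM fV.
have fR u v : f [~ u, v] = [~ f u, f v] by rewrite /commg fM fV fJ.
rewrite /edge /zedge; case: (val t.1) => [|[|n]]; case: (val t.2) => [|m] //.
- by rewrite fJ morph_zexp.
- by rewrite fJ morph_zexp.
- by case: e; rewrite fJ fR !morph_zexp.
Qed.
End EdgeMorphism.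

Lemma zexpV (G : groupType) (g : G) n : (zexp g^-1 n = (zexp g n)^-1)%g.
Proof. by rewrite /zexp /sgn; case: ifP => _; rewrite ?expVgn ?invgK. Qed.

Lemma zexp_one (G : groupType) n : (zexp 1 n = 1 :> G)%g.
Proof. by rewrite /zexp /sgn; case: ifP => _; rewrite ?invg1 expg1n. Qed.

(** The word is obtained by pushing the path of [x]. Each edge evaluates to [s h * d t * (s h')^-1],
    where [h'] is its far end, so the product telescopes and the end terms vanish for a path closing
    at height zero. *)
Lemma std_surj (x : triple) : final (0, 0)%R (triple_word x) = (0, 0)%R ->
  exists w, teq (teval std_gen w) x.
Proof.
set W := triple_word x => HW.
pose E := edge (fgen true idx0) (fgen true idx1) (fgen false idx0) (fgen false idx1) true.
exists (fval (real E (0, 0)%R W)) => j; apply/fgwP; rewrite fgw_teval.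
pose a1 := fgw [:: (idx0, true)]; pose a2 := fgw [:: (idx1, true)].
pose f (g : free_group gen) := ev (fun s => fgw (std_gen s j)) (fval g).
have fM : {morph f : g h / g * h}%g.
  by move=> g h; rewrite /f -ev_cat; apply: ev_freeeq; apply/fgwP; rewrite fgw_val fgw_cat !fgw_val.
have f1 : f 1%g = 1%g by [].
have fV : {morph f : g / g^-1}%g.
  by move=> g; apply: (mulgI (f g)); rewrite mulgV -fM mulgV.
have fgen_f b i : f (fgen b i) = fgw (std_gen (b, i) j).
  by rewrite /f /fgen ev_freduce /= mulg1.
pose s (h : height) := (if j == fac2 then zexp a1 h.1 * zexp a2 h.2 else 1)%g.
pose d (t : edge_type) := (if t.1 == j then fgw [:: (t.2, true)] else 1)%g.
have Hedge t h : f (E t h) = (s h * d t * (s (move h (t, true)))^-1)%g.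
  have o0 (h0 : 0 < 2) : Ordinal h0 = idx0 by exact: val_inj.
  have o1 (h1 : 1 < 2) : Ordinal h1 = idx1 by exact: val_inj.
  rewrite /E morph_edge // !fgen_f /std_gen /s /d.
  have V i : fgw [:: (i, false)] = ((fgw [:: (i, true)])^-1)%g by rewrite -fgw_winv.
  case: j t @s @d {W HW f fM f1 fV fgen_f E x} =>
    [[|[|[|//]]] hj] [[[|[|[|//]]] hT] [[|[|//]] hi]] s d;
    rewrite /edge /zedge /move /= ?fgw_nil ?V ?zexp_one ?conjg1 ?conj1g ?commg1 ?comm1g ?conj1g;
    rewrite ?invg1 ?mulg1 ?mul1g ?zexp1 ?zexpV ?o0 ?o1 //.
  - by rewrite -comm_zexpr; gsimp.
  - by rewrite -comm_zexpr; gsimp.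
  - by rewrite -comm_zexpr; gsimp.
  - by rewrite -comm_zexpr; gsimp.
  - by gsimp.
  - by gsimp.
have Hlabel h y : f (label E h y) = (s h * ev_letter d y * (s (move h y))^-1)%g.
  rewrite /label /ev_letter; case: y => t [] /=; first exact: Hedge.
  rewrite fV Hedge -[(t, true)]/(linv (t, false)) moveK; by gsimp.
have Hreal w h : f (real E h w) = (s h * ev d w * (s (final h w))^-1)%g.
  elim: w h => [|y w IH] h; first by rewrite /= mulg1 mulgV.
  rewrite real_cons fM Hlabel IH /=; by gsimp.
rewrite -/(f _) Hreal HW.
have -> : s (0, 0)%R = 1%g by rewrite /s /zexp /= mulg1; case: ifP.
rewrite mul1g invg1 mulg1 -(proj_triple_word x j) -/W.
elim: (W) => [//|[t b] w IH]; rewrite /= IH /proj /=.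
rewrite /ev_letter /d /=; case: eqP => _ /=; last by case: b; rewrite ?invg1 mul1g.
by rewrite -[(t.2, b) :: _]cat1s fgw_cat; case: b; rewrite //= -?fgw_winv.
Qed.
End StandardPresentation.

(** * The central extension *)

Section Counter.
Local Open Scope Z_scope.
Local Arguments Z.add : simpl never.
Local Arguments Z.sub : simpl never.
Local Arguments Z.mul : simpl never.

(* The first four coordinates are the exponents of x_1, x_2, y_1, y_2, the fifth is
   the difference of the areas swept by the projections to the third and to the
   first factor, and the last one is the coordinate of a central extension of the
   kernel by Z in which Z is quartically distorted. The polynomials solve the linear
   system saying that every relator changes the last coordinate by a constant. *)
Definition state := (Z * Z * Z * Z * Z * Z)%type.

Definition step (s : state) (x : gen * bool) : state :=
  let: (a, b, c, d, t, f) := s in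
  match x.1.1, val x.1.2, x.2 with
  | true, O, true => (a + 1, b, c, d, t, f + 2 * b * (t - a * d))
  | true, O, false => (a - 1, b, c, d, t, f - 2 * b * (t - (a - 1) * d))
  | true, _, true => (a, b + 1, c, d, t + c, f)
  | true, _, false => (a, b - 1, c, d, t - c, f)
  | false, O, true => (a, b, c + 1, d, t, f + b * b * (1 + c))
  | false, O, false => (a, b, c - 1, d, t, f - b * b * c)
  | false, _, true => (a, b, c, d + 1, t + (a + c), f + (2 * c * t - 2 * b * c * c + a * c))
  | false, _, false => (a, b, c, d - 1, t - (a + c),
      f - (2 * c * (t - (a + c)) - 2 * b * c * c + a * c))
  end.

Definition shift (k : Z) (s : state) : state :=
  let: (a, b, c, d, t, f) := s in (a, b, c, d, t, f + k).

Definition zero_state : state := (0, 0, 0, 0, 0, 0).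

Definition defect (w : word gen) : Z := (foldl step zero_state w).2.

Lemma stepK s x : step (step s x) (linv x) = s.
Proof.
by case: s x => [[[[[a b] c] d] t] f] [[[] [[|[|//]] hi]] []]; rewrite /step /=; do ?apply: (congr2 pair) => //; ring.
Qed.

Lemma step_shift k s x : step (shift k s) x = shift k (step s x).
Proof.
by case: s x => [[[[[a b] c] d] t] f] [[[] [[|[|//]] hi]] []]; rewrite /step /=; do ?apply: (congr2 pair) => //; ring.
Qed.

Lemma foldl_shift k s w : foldl step (shift k s) w = shift k (foldl step s w).
Proof. by elim: w s => [//|x w IH] s /=; rewrite step_shift IH. Qed.

Lemma foldl_freeeq s u v : freeeq u v -> foldl step s u = foldl step s v.
Proof. by move=> H; rewrite -(act_freduce stepK) H act_freduce //; apply: stepK. Qed.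

Lemma foldl_winvK s w : foldl step (foldl step s w) (winv w) = s.
Proof.
rewrite -foldl_cat (@foldl_freeeq _ _ [::]) //.
by rewrite /freeeq freduce_winvr.
Qed.

(** Such a word acts as a central element, since [shift] commutes with every step. *)
Definition shifts (w : word gen) : Prop :=
  forall s, foldl step s w = shift (defect w) s.

Fixpoint all_shift (l : seq (word gen)) : Prop :=
  if l is r :: l' then shifts r /\ all_shift l' else True.

Lemma all_shift_relators : all_shift relators.
Proof.
(* With the list computed, each relator leaves polynomial identities in the six coordinates. *)
let l := eval vm_compute in relators in change (all_shift l).
rewrite /all_shift.
repeat split; case=> [[[[[a b] c] d] t] f]; cbv -[Z.add Z.mul Z.sub]; repeat apply: (congr2 pair); ring.
Qed.

Lemma shifts_relator r : r \in relators -> shifts r.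
Proof.
move: all_shift_relators; elim: relators => [//|q l IH] /= [H1 H2].
by rewrite inE => /orP[/eqP->|/(IH H2)].
Qed.

Lemma relators_bound : all (fun r => Z.leb (Z.abs (defect r)) 2) relators.
Proof. by vm_compute. Qed.

Lemma shift_inj s k l : shift k s = shift l s -> k = l.
Proof. by case: s => [[[[[a b] c] d] t] f] []; lia. Qed.

Lemma shiftD k l s : shift k (shift l s) = shift (l + k) s.
Proof. by case: s => [[[[[a b] c] d] t] f] /=; congr pair; ring. Qed.

Lemma shift0 s : shift 0 s = s.
Proof. by case: s => [[[[[a b] c] d] t] f] /=; congr pair; ring. Qed.

(** The shift made by the relator passes through the second half of the conjugator, which cancels
    the first. *)
Lemma defect_conj (p : word gen * word gen * bool) s : p.1.2 \in relators ->
  exists2 k, Z.abs k <= 2 &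
    foldl step s (conj_rel p.1.1 (if p.2 then p.1.2 else winv p.1.2)) = shift k s.
Proof.
move=> Hr; have Hs := shifts_relator Hr.
have Hk : Z.abs (defect p.1.2) <= 2 by apply/Z.leb_le/(allP relators_bound).
rewrite /conj_rel; case: p.2.
  exists (defect p.1.2) => //; rewrite !foldl_cat Hs foldl_shift -foldl_cat.
  by rewrite (@foldl_freeeq _ _ [::]) // /freeeq freduce_winvl.
exists (- defect p.1.2); first by rewrite Z.abs_opp.
have Hw s' : foldl step s' (winv p.1.2) = shift (- defect p.1.2) s'.
  rewrite -{2}(foldl_winvK s' p.1.2) Hs foldl_shift shiftD.
  by rewrite Z.add_opp_diag_r shift0.
rewrite !foldl_cat Hw foldl_shift -foldl_cat.
by rewrite (@foldl_freeeq _ _ [::]) // /freeeq freduce_winvl.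
Qed.

Lemma defect_area w M s k : area_le relators w M -> foldl step s w = shift k s ->
  Z.abs k <= 2 * Z.of_nat M.
Proof.
move=> [l [Hl [HR Hw]]] Hk.
suff [k' Hk' E] : exists2 k', Z.abs k' <= 2 * Z.of_nat (size l) & foldl step s w = shift k' s.
  by move: E; rewrite Hk => /shift_inj ->; lia.
rewrite (foldl_freeeq _ Hw); elim: l s {Hl Hw Hk} HR => [|p l IH] s HR.
  by exists 0 => //=; rewrite shift0.
have [k1 H1 E1] := defect_conj s (HR _ (mem_head _ _)).
have [|k2 H2 E2] := IH s; first by move=> q Hq; apply: HR; rewrite inE Hq orbT.
exists (k2 + k1); last by rewrite /= foldl_cat E1 foldl_shift E2 shiftD.
rewrite [size _]/= Nat2Z.inj_succ; lia.
Qed.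

(** * A word with quartic displacement *)

Definition xpow (b : bool) (i : 'I_2) (e : bool) (n : nat) : word gen := nseq n ((b, i), e).

(** The term in [m * (m - 1)] sums the contribution of the exponent [a], which grows along the way.
    The same polynomial serves negative [m] in [foldl_x1V]. *)
Lemma foldl_x1 n a b c d t f : let m := Z.of_nat n in
  foldl step (a, b, c, d, t, f) (xpow true idx0 true n) =
  (a + m, b, c, d, t, f + 2 * b * m * (t - a * d) - b * d * m * (m - 1)).
Proof.
elim: n a b c d t f => [|n IH] a b c d t f m.
  by rewrite /m /=; repeat apply: (congr2 pair); ring.
rewrite [xpow _ _ _ _]/= [foldl _ _ _]/= IH /m Nat2Z.inj_succ; repeat apply: (congr2 pair); ring.
Qed.

Lemma foldl_x1V n a b c d t f : let m := - Z.of_nat n in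
  foldl step (a, b, c, d, t, f) (xpow true idx0 false n) =
  (a + m, b, c, d, t, f + 2 * b * m * (t - a * d) - b * d * m * (m - 1)).
Proof.
elim: n a b c d t f => [|n IH] a b c d t f m.
  by rewrite /m /=; repeat apply: (congr2 pair); ring.
rewrite [xpow _ _ _ _]/= [foldl _ _ _]/= IH /m Nat2Z.inj_succ; repeat apply: (congr2 pair); ring.
Qed.

Lemma foldl_x2 n a b c d t f : let m := Z.of_nat n in
  foldl step (a, b, c, d, t, f) (xpow true idx1 true n) = (a, b + m, c, d, t + m * c, f).
Proof.
elim: n a b c d t f => [|n IH] a b c d t f m.
  by rewrite /m /=; repeat apply: (congr2 pair); ring.
rewrite [xpow _ _ _ _]/= [foldl _ _ _]/= IH /m Nat2Z.inj_succ; repeat apply: (congr2 pair); ring.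
Qed.

Lemma foldl_x2V n a b c d t f : let m := - Z.of_nat n in
  foldl step (a, b, c, d, t, f) (xpow true idx1 false n) = (a, b + m, c, d, t + m * c, f).
Proof.
elim: n a b c d t f => [|n IH] a b c d t f m.
  by rewrite /m /=; repeat apply: (congr2 pair); ring.
rewrite [xpow _ _ _ _]/= [foldl _ _ _]/= IH /m Nat2Z.inj_succ; repeat apply: (congr2 pair); ring.
Qed.

Lemma foldl_y2 n a b c d t f : let m := Z.of_nat n in
  foldl step (a, b, c, d, t, f) (xpow false idx1 true n) =
  (a, b, c, d + m, t + m * (a + c),
   f + m * (2 * c * t - 2 * b * c * c + a * c) + c * (a + c) * m * (m - 1)).
Proof.
elim: n a b c d t f => [|n IH] a b c d t f m.
  by rewrite /m /=; repeat apply: (congr2 pair); ring.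
rewrite [xpow _ _ _ _]/= [foldl _ _ _]/= IH /m Nat2Z.inj_succ; repeat apply: (congr2 pair); ring.
Qed.

Lemma foldl_y2V n a b c d t f : let m := - Z.of_nat n in
  foldl step (a, b, c, d, t, f) (xpow false idx1 false n) =
  (a, b, c, d + m, t + m * (a + c),
   f + m * (2 * c * t - 2 * b * c * c + a * c) + c * (a + c) * m * (m - 1)).
Proof.
elim: n a b c d t f => [|n IH] a b c d t f m.
  by rewrite /m /=; repeat apply: (congr2 pair); ring.
rewrite [xpow _ _ _ _]/= [foldl _ _ _]/= IH /m Nat2Z.inj_succ; repeat apply: (congr2 pair); ring.
Qed.

Definition wcomm (u v : word gen) : word gen := winv u ++ winv v ++ u ++ v.

(* The commutator of [([a_1^n, a_2^n], 1, 1)] with [(1, 1, [a_1^-n, a_2^-n])]. *)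
Definition quartic_word (n : nat) : word gen :=
  wcomm (wcomm (xpow true idx0 true n) (xpow true idx1 true n ++ xpow false idx1 false n))
        (wcomm (xpow true idx0 true n) (xpow false idx1 true n)).

Lemma winv_xpow b i e n : winv (xpow b i e n) = xpow b i (~~ e) n.
Proof. by rewrite /winv /xpow map_nseq rev_nseq. Qed.

Lemma quartic_defect n : foldl step zero_state (quartic_word n) =
  shift (2 * Z.of_nat n ^ 4) zero_state.
Proof.
rewrite /quartic_word /wcomm !(winv_cat, winv_xpow, foldl_cat) /zero_state [~~ true]/= [~~ false]/=.
do !rewrite ?(foldl_x1, foldl_x1V, foldl_x2, foldl_x2V, foldl_y2, foldl_y2V).
rewrite /shift; repeat apply: (congr2 pair); ring.
Qed.

Lemma size_quartic_word n : size (quartic_word n) = (20 * n)%N.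
Proof.
rewrite /quartic_word /wcomm !(winv_cat, winv_xpow) !size_cat !size_nseq; lia.
Qed.

End Counter.

(** * The Dehn function *)

Section QuarticNull.
Local Open Scope group_scope.
Variables (G : groupType) (f : gen -> G).

Lemma ev_wcomm u v : ev f (wcomm u v) = [~ ev f u, ev f v].
Proof. by rewrite /wcomm !ev_cat !ev_winv. Qed.

Lemma ev_xpow b i e n : ev f (xpow b i e n) = ev_letter f (b, i, e) ^+ n.
Proof. by elim: n => [//|n IH]; rewrite expgS /= IH. Qed.
End QuarticNull.

(** In each coordinate at least one of the two inner commutators is trivial; [std_upper] turns this
    into null-homotopy. *)
Lemma quartic_null n : null_hom relators (quartic_word n).
Proof.
exists (10000 * (size (quartic_word n) + 1) ^ 4)%N; apply: std_upper => j.
apply/fgwP; rewrite fgw_teval /quartic_word !(ev_wcomm, ev_cat, ev_xpow) /ev_letter.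
case: j => [[|[|[|//]]] hj]; rewrite /std_gen /= ?fgw_nil ?invg1 ?expg1n ?commg1 ?comm1g //.
by rewrite expVgn mulgV commg1 comm1g.
Qed.

Section Extremum.
Let asbool (P : Prop) : bool := if excluded_middle_informative P then true else false.

Let asboolP P : reflect P (asbool P).
Proof. by rewrite /asbool; case: excluded_middle_informative => H; constructor. Qed.

Lemma classical_min (P : nat -> Prop) : (exists n, P n) ->
  exists m, P m /\ forall n, P n -> m <= n.
Proof.
move=> [n0 H0]; have ex : exists n, asbool (P n) by exists n0; apply/asboolP.
by case: (ex_minnP ex) => m /asboolP Pm le; exists m; split=> // n /asboolP/le.
Qed.

Lemma classical_max (P : nat -> Prop) B : (exists n, P n) -> (forall n, P n -> n <= B) ->
  exists m, P m /\ forall n, P n -> n <= m.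
Proof.
move=> [n0 H0] HB; have ex : exists n, asbool (P n) by exists n0; apply/asboolP.
have ub n : asbool (P n) -> n <= B by move/asboolP/HB.
by case: (ex_maxnP ex ub) => m /asboolP Pm le; exists m; split=> // n /asboolP/le.
Qed.
End Extremum.

Section DehnFunction.
Variables (S : finType) (R : seq (word S)).

Lemma Area_spec w : null_hom R w ->
  area_le R w (Area R w) /\ forall M, area_le R w M -> Area R w <= M.
Proof. by move=> /classical_min H; apply: epsilon_spec H. Qed.

Variable C : nat.
Hypothesis upper : forall w, null_hom R w -> area_le R w (C * (size w + 1) ^ 4).

Lemma Area_upper w : null_hom R w -> Area R w <= C * (size w + 1) ^ 4.
Proof. by move=> Hw; apply: (Area_spec Hw).2; apply: upper. Qed.

(** [Dehn] chooses a maximum, so it has its meaning only where one exists; the hypothesis [upper]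
    bounds the set of areas, and the empty word makes it inhabited. *)
Lemma Dehn_spec N :
  (exists w, size w <= N /\ null_hom R w /\ Area R w = Dehn R N) /\
  forall w, size w <= N -> null_hom R w -> Area R w <= Dehn R N.
Proof.
apply: (@epsilon_spec _ (inhabits 0) (fun D =>
  (exists w, size w <= N /\ null_hom R w /\ Area R w = D) /\
  forall w, size w <= N -> null_hom R w -> Area R w <= D)).
have [||m [Hm Hmax]] := @classical_max
  (fun D => exists w, size w <= N /\ null_hom R w /\ Area R w = D) (C * (N + 1) ^ 4).
- exists (Area R [::]), [::]; do !split=> //.
  by exists 0, [::]; do !split.
- move=> _ [w [sw [nw <-]]]; apply: leq_trans (Area_upper nw) _.
  by rewrite leq_mul2l leq_exp2r // leq_add2r sw orbT.
- by exists m; split=> // w sw nw; apply: Hmax; exists w.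
Qed.

Lemma Dehn_quartic c :
  (forall n, exists w, [/\ size w <= c * n, null_hom R w &
     forall M, area_le R w M -> n ^ 4 <= M]) ->
  dehn_equiv (Dehn R) (fun N => N ^ 4).
Proof.
move=> lower; split.
- exists C.+1; split=> // N; have [[w [sw [nw <-]]] _] := Dehn_spec N.
  apply: leq_trans (Area_upper nw) _; rewrite -addnA; apply: leq_trans (leq_addr _ _).
  apply: leq_mul => //; rewrite leq_exp2r //; nia.
(* The word for [n = N] has length at most [c * N], within the rescaled argument of [Dehn]. *)
- exists c.+1; split=> // N; have [w [sw nw Hw]] := lower N.
  have [_ le] := Dehn_spec (c.+1 * N + c.+1).
  have H1 : size w <= c.+1 * N + c.+1 by apply: leq_trans sw _; nia.
  have [Hl _] := Area_spec nw; have := leq_trans (Hw _ Hl) (le _ H1 nw).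
  move: (Dehn _ _) => D H2; apply: leq_trans H2 _; nia.
Qed.
End DehnFunction.

Lemma Dehn_relators : dehn_equiv (Dehn relators) (fun N => N ^ 4).
Proof.
apply: (@Dehn_quartic _ _ 10000 _ 20) => [w /std_sound/std_upper //|n].
exists (quartic_word n); split; [by rewrite size_quartic_word|exact: quartic_null|].
(* A displacement of [2 * n ^ 4], at most 2 per relator, forces area at least [n ^ 4]. *)
move=> M /defect_area/(_ (quartic_defect n)) H.
suff E : Z.of_nat (n ^ 4) = Z.pow (Z.of_nat n) 4 by move: H; rewrite -E; lia.
by rewrite !expnS expn0 !Nat2Z.inj_mul; ring.
Qed.

(** * Bases of the free group adapted to a surjection *)

Section Bases.
Notation F := (free_group 'I_2).
Implicit Types (al be ga nu : 'I_2 -> F) (g h : F).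

Definition fvar (j : 'I_2) : F := fgw [:: (j, true)].
Definition hom al g : F := ev al (fval g).

Lemma hom_fgw al w : hom al (fgw w) = ev al w.
Proof. exact: ev_freduce. Qed.

Lemma homM al g h : hom al (g * h)%g = (hom al g * hom al h)%g.
Proof. by rewrite -(fgw_val g) -(fgw_val h) -fgw_cat !hom_fgw ev_cat. Qed.

Lemma homV al g : hom al g^-1%g = (hom al g)^-1%g.
Proof. by rewrite -(fgw_val g) -fgw_winv !hom_fgw ev_winv. Qed.

Lemma hom_fvar al j : hom al (fvar j) = al j.
Proof. by rewrite hom_fgw /= mulg1. Qed.

Lemma hom_ev (T : choiceType) (f : T -> F) al w :
  hom al (ev f w) = ev (fun s => hom al (f s)) w.
Proof.
elim: w => [//|[s b] w IH]; rewrite /= homM IH; congr (_ * _)%g.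
by case: b; rewrite /ev_letter //= homV.
Qed.

Lemma hom_comp al be g : hom al (hom be g) = hom (fun j => hom al (be j)) g.
Proof. by rewrite {2}/hom hom_ev. Qed.

Lemma hom_ext al be g : al =1 be -> hom al g = hom be g.
Proof. by move=> E; apply: eq_ev. Qed.

Lemma hom_id g : hom fvar g = g.
Proof. by rewrite -[RHS]fgw_val -ev_fgw. Qed.

Definition inverse_homs al be : Prop :=
  (forall j, hom al (be j) = fvar j) /\ (forall j, hom be (al j) = fvar j).

(** Being a basis is expressed as invertibility of the induced endomorphism, which composes well
    with Nielsen moves. *)
Definition basis al : Prop := exists be, inverse_homs al be.

Lemma inverse_homsK al be g : inverse_homs al be -> hom al (hom be g) = g.
Proof. by move=> [H _]; rewrite hom_comp (hom_ext _ H) hom_id. Qed.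

Lemma inverse_homs_sym al be : inverse_homs al be -> inverse_homs be al.
Proof. by case. Qed.

Lemma basis_comp al nu : basis al -> basis nu -> basis (fun j => hom al (nu j)).
Proof.
move=> [be Hb] [mu Hm]; exists (fun j => hom mu (be j)); split=> j.
  by rewrite -hom_comp (inverse_homsK _ Hm); apply: Hb.1.
rewrite -(hom_comp mu be) (inverse_homsK _ (inverse_homs_sym Hb)).
exact: Hm.2.
Qed.

Definition pair2 g h : 'I_2 -> F := fun j => if j == idx0 then g else h.

Lemma pair2_fvar (P : 'I_2 -> Prop) : P idx0 -> P idx1 -> forall j, P j.
Proof.
move=> P0 P1 j; have [->//|] := eqVneq j idx0.
case: j => [[|[|//]] hj] // _.
by have -> : Ordinal hj = idx1 by apply: val_inj.
Qed.

Let x := fvar idx0.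
Let y := fvar idx1.

Lemma basis_swap : basis (pair2 y x).
Proof. by exists (pair2 y x); split; apply: pair2_fvar; rewrite hom_fvar. Qed.

Lemma basis_inv : basis (pair2 x^-1%g y).
Proof.
by exists (pair2 x^-1%g y); split; apply: pair2_fvar; rewrite ?homV hom_fvar ?invgK.
Qed.

Lemma basis_mul : basis (pair2 (x * y)%g y).
Proof.
exists (pair2 (x * y^-1)%g y); split; apply: pair2_fvar;
  by rewrite ?homM ?homV !hom_fvar //= ?mulgK ?mulgVK.
Qed.

(** * Euclidean algorithm on bases *)

Section Euclid.
Local Open Scope ring_scope.
Variable chi : F -> 'rV[int]_2.
Hypothesis chiM : forall g h, chi (g * h)%g = chi g + chi h.
Implicit Types u v : 'rV[int]_2.

Lemma chi1 : chi 1%g = 0.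
Proof. by apply: (addrI (chi 1%g)); rewrite -chiM mulg1 addr0. Qed.

Lemma chiV g : chi g^-1%g = - chi g.
Proof. by apply: (addrI (chi g)); rewrite -chiM mulgV subrr chi1. Qed.

(** Nielsen moves on a basis act on the pair of its images as integer row operations. *)
Definition realized u v : Prop :=
  exists al, [/\ basis al, chi (al idx0) = u & chi (al idx1) = v].

Lemma realized_swap u v : realized u v -> realized v u.
Proof.
move=> [al [H0 H1 H2]]; exists (fun j => hom al (pair2 y x j)).
by split; [apply: basis_comp H0 basis_swap| |]; rewrite /pair2 /= hom_fvar.
Qed.

Lemma realized_neg u v : realized u v -> realized (- u) v.
Proof.
move=> [al [H0 H1 H2]]; exists (fun j => hom al (pair2 x^-1%g y j)).
by split; [apply: basis_comp H0 basis_inv| |]; rewrite /pair2 /= ?homV hom_fvar ?chiV ?H1.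
Qed.

Lemma realized_add u v : realized u v -> realized (u + v) v.
Proof.
move=> [al [H0 H1 H2]]; exists (fun j => hom al (pair2 (x * y)%g y j)).
split; [apply: basis_comp H0 basis_mul| |]; rewrite /pair2 /= ?homM !hom_fvar //.
by rewrite chiM H1 H2.
Qed.

Lemma realized_sub u v : realized u v -> realized (u - v) v.
Proof. by move=> /realized_neg/realized_add/realized_neg; rewrite opprD opprK. Qed.

Let i0 : 'I_2 := idx0.
Let i1 : 'I_2 := idx1.

(** Euclid's algorithm on first coordinates: the vector with the smaller entry is added to or
    subtracted from the other, whichever lowers the larger absolute value. *)
Lemma realized_reduce u v : realized u v -> exists u' v', realized u' v' /\ v' 0 i0 = 0.
Proof.
have [n] := ubnP (absz (u 0 i0) + absz (v 0 i0)); elim: n u v => [//|n IH] u v Hn H.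
have [v0|v0] := eqVneq (v 0 i0) 0; first by exists u, v.
have [u0|u0] := eqVneq (u 0 i0) 0; first by exists v, u; split=> //; apply: realized_swap.
wlog le : u v Hn H v0 u0 / (absz (v 0%R i0) <= absz (u 0%R i0))%N.
  move=> W; have [le|/ltnW le] := leqP (absz (v 0%R i0)) (absz (u 0%R i0)); first exact: (W u v).
  by apply: (W v u) => //; [rewrite addnC|apply: realized_swap].
have [s|s] : (absz (u 0 i0 - v 0 i0)%R < absz (u 0%R i0))%N \/
             (absz (u 0 i0 + v 0 i0)%R < absz (u 0%R i0))%N.
  by move: (u 0 i0) (v 0 i0) u0 v0 le => a b; lia.
- apply: (IH _ _ _ (realized_sub H)); rewrite !mxE; by apply: leq_trans _ (Hn : _ <= n)%N; rewrite ltn_add2r.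
- apply: (IH _ _ _ (realized_add H)); rewrite !mxE; by apply: leq_trans _ (Hn : _ <= n)%N; rewrite ltn_add2r.
Qed.

Lemma chi_ev al w : exists p q, chi (ev al w) = chi (al idx0) *~ p + chi (al idx1) *~ q.
Proof.
elim: w => [|[j b] w [p [q E]]]; first by exists 0, 0; rewrite /= chi1 !mulr0z addr0.
rewrite /= chiM E; case: b; rewrite /ev_letter /= ?chiV; move: j; apply: pair2_fvar.
- by exists (1 + p), q; rewrite mulrzDr mulr1z addrA.
- by exists p, (1 + q); rewrite mulrzDr mulr1z addrCA.
- by exists (- 1 + p), q; rewrite mulrzDr mulrN1z addrA.
- by exists p, (- 1 + q); rewrite mulrzDr mulrN1z addrCA.
Qed.

Lemma realized_span u v g : realized u v -> exists p q, chi g = u *~ p + v *~ q.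
Proof.
move=> [al [[be Hb] <- <-]]; rewrite -(inverse_homsK g Hb) /hom; exact: chi_ev.
Qed.

Lemma row2P u v : u 0 i0 = v 0 i0 -> u 0 i1 = v 0 i1 -> u = v.
Proof.
move=> E0 E1; apply/rowP => j; rewrite -!/(_ 0 _).
by move: j; apply: pair2_fvar.
Qed.

Lemma mulrz_coord u (p : int) j : (u *~ p) 0 j = u 0 j * p.
Proof. by rewrite -scaler_int mxE intz mulrC. Qed.

Hypothesis chi_surj : forall z, exists g, chi g = z.

Let e (j : 'I_2) : 'rV[int]_2 := delta_mx 0 j.

Lemma unit_mul1 (a b : int) : a * b = 1 -> a = 1 \/ a = -1.
Proof.
move=> H; have := congr1 absz H; rewrite abszM => /eqP; rewrite muln_eq1.
by case/andP=> /eqP h _; lia.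
Qed.

(** After Euclid the images form a triangular matrix. Surjectivity makes its diagonal entries units;
    sign changes and multiples of the second row then give the identity. *)
Lemma exists_standard_basis : exists al, basis al /\ forall j, chi (al j) = e j.
Proof.
have [u [v [H v0]]] : exists u v, realized u v /\ v 0 i0 = 0.
  apply: (@realized_reduce (chi x) (chi y)); exists fvar; split=> //.
  by exists fvar; split=> j; rewrite hom_fvar.
have {}[g0 Eg0] := chi_surj (e i0); have {}[g1 Eg1] := chi_surj (e i1).
have [p [q Epq]] := realized_span g0 H; have [p' [q' Epq']] := realized_span g1 H.
rewrite Eg0 in Epq; rewrite Eg1 in Epq'.
have c0 : u 0 i0 * p = 1.
  by have := congr1 (fun w : 'rV[int]_2 => w 0 i0) Epq; rewrite mxE mxE !mulrz_coord v0 mul0r addr0 eqxx => <-.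
have c1 : u 0 i0 * p' = 0.
  by have := congr1 (fun w : 'rV[int]_2 => w 0 i0) Epq'; rewrite mxE mxE !mulrz_coord v0 mul0r addr0 => <-.
have p'0 : p' = 0.
  by move/eqP: c1; rewrite mulf_eq0 => /orP[/eqP z|/eqP //]; rewrite z mul0r in c0.
have c2 : v 0 i1 * q' = 1.
  have := congr1 (fun w : 'rV[int]_2 => w 0 i1) Epq'.
  by rewrite mxE mxE !mulrz_coord p'0 mulr0 add0r eqxx => <-.
have {H} [v' [H v'E]] : exists v', realized u v' /\ v' = e i1.
  have [a|a] := unit_mul1 c2.
    by exists v; split=> //; apply: row2P; rewrite ?v0 ?a mxE.
  exists (- v); split; first by apply/realized_swap/realized_neg/realized_swap.
  by apply: row2P; rewrite !mxE ?v0 ?a.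
rewrite {}v'E in H.
have {H c0} [u' [H u'0]] : exists u', realized u' (e i1) /\ u' 0 i0 = 1.
  have [a|a] := unit_mul1 c0; first by exists u.
  by exists (- u); split; [apply: realized_neg|rewrite mxE a].
have [al [H1 H2 H3]] : realized (e i0) (e i1).
  (* Each addition or subtraction of [e i1] brings the remaining entry one closer to zero. *)
  have [n] := ubnP (absz (u' 0 i1)); elim: n u' u'0 H => [//|n IH] u' u'0 H Hn.
  have [z|z] := eqVneq (u' 0 i1) 0.
    by have <- : u' = e i0 by apply: row2P; rewrite ?u'0 ?z mxE.
  have [s|s] := boolP (0 <= u' 0 i1).
    apply: (IH _ _ (realized_sub H)); rewrite !mxE /= ?u'0 ?subr0 //.
    by move: (u' 0 i1) Hn z s => a; lia.
  apply: (IH _ _ (realized_add H)); rewrite !mxE /= ?u'0 ?addr0 //.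
  by move: (u' 0 i1) Hn z s => a; lia.
by exists al; split=> //; apply: pair2_fvar.
Qed.
End Euclid.
End Bases.

(** * Reduction of a general homomorphism to the standard one *)

Section Transport.
Local Open Scope ring_scope.

(** Both sides are additive along the word and agree on letters, so heights compute the image in
    [Z^2]. *)
Lemma final_lift_word (de : free_group 'I_2 -> 'rV[int]_2) (T : 'I_3) u h :
  (forall g k, de (g * k)%g = de g + de k) -> (forall j, de (fvar j) = delta_mx 0 j) ->
  final h (lift_word T u) = (h.1 + de (fgw u) 0 idx0, h.2 + de (fgw u) 0 idx1).
Proof.
move=> deM deE; elim: u h => [|[j b] u IH] [h1 h2].
  by rewrite /= (chi1 deM) !mxE !addr0.
rewrite /= IH -cat1s fgw_cat deM.
have -> : de (fgw [:: (j, b)]) = if b then delta_mx 0 j else - delta_mx 0 j.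
  case: b; first exact: deE.
  by rewrite -deE -(chiV deM) -fgw_winv.
rewrite /move /= !mxE; move: j; apply: pair2_fvar => /=; case: b; rewrite !mxE /=; congr pair; lia.
Qed.

(** A basis adapted to each factor separately turns [phi] into the sum of the abelianizations. The
    relators are thus the same for every [phi], and only [psi] varies. *)
Lemma relators_present_kernel (phi : triple -> 'rV[int]_2) :
  is_hom3 phi -> factor_surj phi ->
  exists psi : gen -> triple, presents_kernel relators phi psi.
Proof.
move=> [phiE phiM] surj.
pose chi (i : 'I_3) (g : free_group 'I_2) := phi (factor_inj i (fval g)).
have chi_fgw i u : chi i (fgw u) = phi (factor_inj i u).
  apply: phiE => j; rewrite /factor_inj; case: eqP => // _.
  by rewrite /freeeq freduceK.
have chiM i g h : chi i (g * h)%g = chi i g + chi i h.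
  rewrite -(fgw_val g) -(fgw_val h) -fgw_cat !chi_fgw -phiM; apply: phiE => j.
  by rewrite /tmul /factor_inj; case: eqP.
have phi_sum x : phi x = chi fac0 (fgw (x fac0)) + (chi fac1 (fgw (x fac1)) + chi fac2 (fgw (x fac2))).
  rewrite !chi_fgw -!phiM; apply: phiE => j; rewrite /tmul /factor_inj.
  by case: j => [[|[|[|//]]] hj]; rewrite /= ?cats0; congr (freduce (x _)); apply: val_inj.
have std i : exists ab : ('I_2 -> free_group 'I_2) * ('I_2 -> free_group 'I_2),
    inverse_homs ab.1 ab.2 /\ forall j, chi i (ab.1 j) = delta_mx 0 j.
  have [|al [[be Hb] Hal]] := exists_standard_basis (chiM i); last by exists (al, be).
  by move=> z; have [u Hu] := surj i z; exists (fgw u); rewrite chi_fgw.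
have [ab Hab] := fin_all_exists std.
pose al i := (ab i).1; pose be i := (ab i).2.
have K i g : hom (al i) (hom (be i) g) = g by apply: inverse_homsK (Hab i).1.
have K' i g : hom (be i) (hom (al i) g) = g by apply/inverse_homsK/inverse_homs_sym/(Hab i).1.
pose de i g := chi i (hom (al i) g).
have deM i g h : de i (g * h)%g = de i g + de i h by rewrite /de homM chiM.
have deE i j : de i (fvar j) = delta_mx 0 j by rewrite /de hom_fvar (Hab i).2.
pose psi (s : gen) : triple := fun j => fval (hom (al j) (fgw (std_gen s j))).
have psiE w j : fgw (teval psi w j) = hom (al j) (fgw (teval std_gen w j)).
  rewrite !fgw_teval hom_ev; apply: eq_ev => s; exact: fgw_val.
have teqP x y : teq x y <-> forall j, fgw (x j) = fgw (y j).
  by split=> H j; apply/fgwP/H.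
have hom1 i : hom (al i) 1%g = 1%g by [].
exists psi; split.
- move=> [b i]; rewrite phi_sum /psi !fgw_val -!/(de _ _).
  have -> : de fac2 (fgw (std_gen (b, i) fac2)) = - delta_mx 0 i.
    by rewrite /std_gen; case: b; rewrite /= -(deE fac2) -(chiV (deM fac2)) -fgw_winv.
  case: b.
    have -> : de fac0 (fgw (std_gen (true, i) fac0)) = delta_mx 0 i by exact: deE.
    have -> : de fac1 (fgw (std_gen (true, i) fac1)) = 0 by exact: (chi1 (deM fac1)).
    by rewrite add0r subrr.
  have -> : de fac0 (fgw (std_gen (false, i) fac0)) = 0 by exact: (chi1 (deM fac0)).
  have -> : de fac1 (fgw (std_gen (false, i) fac1)) = delta_mx 0 i by exact: deE.
  by rewrite add0r subrr.
- move=> r Hr; apply/teqP => j; rewrite psiE.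
  suff /std_sound/(_ j)/fgwP -> : null_hom relators r by apply: hom1.
  by exists 1%N; apply/cost_fgw/cost_relator.
(* [y] is [x] in the adapted bases; its path closes at height zero exactly because [phi x = 0]. *)
- move=> x Hx; pose y : triple := fun j => fval (hom (be j) (fgw (x j))).
  have [|w /teqP Hw] := @std_surj y.
    rewrite /triple_word /final !foldl_cat -!/(final _ _).
    rewrite (final_lift_word fac0 _ _ (deM fac0) (deE fac0)) (final_lift_word fac1 _ _ (deM fac1) (deE fac1)).
    rewrite (final_lift_word fac2 _ _ (deM fac2) (deE fac2)) /= !add0r /y !fgw_val /de !K.
    move: Hx; rewrite phi_sum addrA => /rowP E.
    by congr pair; [move: (E idx0)|move: (E idx1)]; rewrite !mxE.
  by exists w; apply/teqP => j; rewrite psiE Hw /y fgw_val K.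
- move=> w /teqP Hw; exists (10000 * (size w + 1) ^ 4)%N; apply: std_upper.
  by apply/teqP => j; rewrite -[LHS](K' j) -psiE Hw.
Qed.
End Transport.

Theorem theoremA (phi : triple -> 'rV[int]_2) :
  is_hom3 phi -> factor_surj phi ->
  exists (S : finType) (R : seq (word S)) (psi : S -> triple),
    presents_kernel R phi psi /\ dehn_equiv (Dehn R) (fun N => N ^ 4).
Proof.
move=> hphi surj; have [psi Hpsi] := relators_present_kernel hphi surj.
by exists gen, relators, psi; split; last exact: Dehn_relators.
Qed.
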